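(* The 3D matching problem can be polynomially reduced to the Intersection-Heavy $\{0,1\}$ Simultaneous Minimum Spanning Trees problem ($\cap$-01-SMST) for $3$ graphs (in its decision form: does a solution exist?).
   Context: 3D matching: given disjoint finite sets $U,V,W$ with $|U|=|V|=|W|=k$ and $T\subseteq U\times V\times W$, decide whether there is $M\subseteq T$ with $|M|=k$ such that every $x\in U\cup V\cup W$ lies in exactly one element of $M$. An instance of the Simultaneous Minimum Spanning Trees problem consists of a positive integer $k$, graphs $G_1=(V_1,E_1),\dots,G_k=(V_k,E_k)$ and a weight function $w:\bigcup_i E_i\to\mathbb{R}_{\ge 0}$, such that there is a set $\bar V$ with $\bar V=V_i\cap V_j$ for all $i\ne j$, and a graph $\bar G$ with $\bar G=G_i[\bar V]$ for every $i$. A spanning tree of a graph is a maximal acyclic subgraph (a spanning forest); a minimum spanning tree is one of minimum total weight. A solution is an edge set $T\subseteq\bigcup_i E_i$ such that $T\cap E_i$ is a minimum spanning tree of $G_i$ for every $i$. $\cap$-01-SMST is the restriction to instances where all weights are $0$ or $1$ and every edge of weight $1$ lies in $\bar G$. *)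

(* Defs.v *)
From HB Require Import structures.
From mathcomp Require Import all_boot all_order all_algebra.
From mathcomp Require Import finmap reals.

Set Implicit Arguments.
Unset Strict Implicit.
Unset Printing Implicit Defensive.

Import Order.TTheory GRing.Theory Num.Theory.

Local Open Scope fset_scope.

Inductive symbol := Zero | One | Open | Close.

Definition word := seq symbol.

Inductive direction := MoveLeft | Stay | MoveRight.

(* A two-way infinite tape: [left] lists the cells to the left of the head,
   nearest first, and all cells not listed are blank.  [None] is the blank. *)
Record tape (A : Type) := Tape {
  left : seq (option A);
  cur : option A;
  right : seq (option A) }.

Definition write (A : Type) (a : option A) (t : tape A) : tape A :=
  Tape (left t) a (right t).

Definition shift (A : Type) (d : direction) (t : tape A) : tape A :=
  match d with
  | MoveLeft => Tape (behead (left t)) (head None (left t)) (cur t :: right t)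
  | Stay => t
  | MoveRight => Tape (cur t :: left t) (head None (right t)) (behead (right t))
  end.

(* The tape alphabet consists of the input symbols, the auxiliary symbols
   [tm_aux] and the blank; there are [tm_tapes.+1] tapes. *)
Record turing_machine := TuringMachine {
  tm_state : finType;
  tm_aux : finType;
  tm_tapes : nat;
  tm_start : tm_state;
  tm_halt : pred tm_state;
  tm_trans : tm_state -> {ffun 'I_tm_tapes.+1 -> option (symbol + tm_aux)} ->
    tm_state * {ffun 'I_tm_tapes.+1 -> option (symbol + tm_aux) * direction} }.

Definition config (M : turing_machine) : Type :=
  tm_state M * {ffun 'I_(tm_tapes M).+1 -> tape (symbol + tm_aux M)}.

(* Halted configurations are fixed, so [iter n (step (M := M)) c] is halted
   exactly when [M] halts from [c] after at most [n] steps. *)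
Definition step (M : turing_machine) (c : config M) : config M :=
  if tm_halt c.1 then c else
  let qa := tm_trans c.1 [ffun i => cur (c.2 i)] in
  (qa.1, [ffun i => shift (qa.2 i).2 (write (qa.2 i).1 (c.2 i))]).

Definition input_tape (A : Type) (s : word) : tape (symbol + A) :=
  if s is a :: s' then Tape [::] (Some (inl a)) [seq Some (inl b) | b <- s']
  else Tape [::] None [::].

(* The input is on the first tape; the other tapes are blank. *)
Definition init (M : turing_machine) (s : word) : config M :=
  (tm_start M,
   [ffun i : 'I_(tm_tapes M).+1 =>
      if i == ord0 then input_tape (tm_aux M) s else input_tape (tm_aux M) [::]]).

Fixpoint read (A : Type) (cs : seq (option (symbol + A))) : word :=
  if cs is Some (inl a) :: cs' then a :: read cs' else [::].

(* The output is the maximal word of input symbols on the last tape that starts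
   at the head. *)
Definition output (M : turing_machine) (c : config M) : word :=
  read (cur (c.2 ord_max) :: right (c.2 ord_max)).

Definition computes_within (M : turing_machine) (n : nat) (s s' : word) : Prop :=
  let c := iter n (@step M) (init M s) in tm_halt c.1 /\ output c = s'.

Definition poly_time_on (D : word -> Prop) (f : word -> word) : Prop :=
  exists (M : turing_machine) (p : {poly nat}),
    forall s, D s -> computes_within M p.[size s]%R s (f s).

Record decision_problem := DecisionProblem {
  instance : word -> Prop;
  yes_instance : word -> Prop }.

(* Many-one (Karp) reduction: instances are mapped to instances, and nothing is
   required on the words that do not encode an instance. *)
Definition poly_reduces (P Q : decision_problem) : Prop :=
  exists f : word -> word,
    poly_time_on (instance P) f /\
    forall s, instance P s ->
      instance Q (f s) /\ (yes_instance P s <-> yes_instance Q (f s)).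

(* The elements of ground sets and the vertices of graphs are bit strings. *)
Definition name := seq bool.

Definition bit (b : bool) : symbol := if b then One else Zero.

Definition bracket (s : word) : word := Open :: s ++ [:: Close].

Definition enc_name (x : name) : word := bracket (map bit x).

Definition enc_seq (A : Type) (enc : A -> word) (l : seq A) : word :=
  bracket (flatten (map enc l)).

Definition enc_triple (t : name * name * name) : word :=
  bracket (enc_name t.1.1 ++ enc_name t.1.2 ++ enc_name t.2).

(* An edge given by its two ends (in either order) and its weight, 0 or 1. *)
Definition enc_wedge (e : name * name * bool) : word :=
  bracket (enc_name e.1.1 ++ enc_name e.1.2 ++ [:: bit e.2]).

Definition enc_wgraph (G : seq name * seq (name * name * bool)) : word :=
  bracket (enc_seq enc_name G.1 ++ enc_seq enc_wedge G.2).

Record tdm := Tdm {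
  tdmU : {fset name};
  tdmV : {fset name};
  tdmW : {fset name};
  tdmT : {fset name * name * name} }.

Definition tdm_valid (I : tdm) : Prop :=
  [/\ [/\ [disjoint tdmU I & tdmV I], [disjoint tdmU I & tdmW I]
        & [disjoint tdmV I & tdmW I]],
      #|` tdmU I| = #|` tdmV I|, #|` tdmU I| = #|` tdmW I|
    & forall u v w, (u, v, w) \in tdmT I ->
        [/\ u \in tdmU I, v \in tdmV I & w \in tdmW I]].

Definition in_triple (x : name) (t : name * name * name) : Prop :=
  [\/ x = t.1.1, x = t.1.2 | x = t.2].

Definition has_3d_matching (I : tdm) : Prop :=
  exists M : {fset name * name * name},
    [/\ M `<=` tdmT I, #|` M| = #|` tdmU I|
      & forall x, x \in tdmU I `|` tdmV I `|` tdmW I ->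
          exists! t, t \in M /\ in_triple x t].

(* Each set is listed without repetition, in an arbitrary order, so an instance
   may have several encodings; a word encodes at most one instance. *)
Definition encodes_tdm (s : word) (I : tdm) : Prop :=
  exists (us vs ws : seq name) (ts : seq (name * name * name)),
    [/\ perm_eq us (tdmU I), perm_eq vs (tdmV I), perm_eq ws (tdmW I),
        perm_eq ts (tdmT I)
      & s = enc_seq enc_name us ++ enc_seq enc_name vs ++
            enc_seq enc_name ws ++ enc_seq enc_triple ts].

Definition three_dim_matching : decision_problem := {|
  instance s := exists I, encodes_tdm s I /\ tdm_valid I;
  yes_instance s := exists I, [/\ encodes_tdm s I, tdm_valid I & has_3d_matching I]
|}.

Definition edge := {fset name}.

Record graph := Graph { verts : {fset name}; edges : {fset edge} }.

Definition simple_graph (G : graph) : Prop :=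
  forall e : edge, e \in edges G -> e `<=` verts G /\ #|` e| = 2.

Definition induced (G : graph) (X : {fset name}) : graph :=
  Graph X [fset e in edges G | e `<=` X].

Definition adj (F : {fset edge}) : rel name := fun x y => [fset x; y] \in F.

Definition acyclic (F : {fset edge}) : Prop :=
  forall c : seq name, 2 < size c -> ~ ucycle (adj F) c.

(* A spanning tree (forest) of [G] has all vertices of [G] and is identified
   with its edge set. *)
Definition spanning_tree (G : graph) (T : {fset edge}) : Prop :=
  [/\ T `<=` edges G, acyclic T
    & forall F : {fset edge}, F `<=` edges G -> acyclic F -> T `<=` F -> F = T].

Definition total_weight (R : realType) (w : edge -> R) (T : {fset edge}) : R :=
  (\sum_(e <- T) w e)%R.

Definition min_spanning_tree (R : realType) (G : graph) (w : edge -> R)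
    (T : {fset edge}) : Prop :=
  spanning_tree G T /\
  forall T', spanning_tree G T' -> (total_weight w T <= total_weight w T')%R.

(* Only the values of [smst_weight] on the edges of the graphs are relevant. *)
Record smst (R : realType) (k : nat) := Smst {
  smst_graph : 'I_k -> graph;
  smst_weight : edge -> R }.

Definition smst_core (R : realType) (k : nat) (I : smst R k)
    (Vbar : {fset name}) (Gbar : graph) : Prop :=
  [/\ forall i, Vbar `<=` verts (smst_graph I i),
      forall i j, i != j ->
        Vbar = verts (smst_graph I i) `&` verts (smst_graph I j)
    & forall i, Gbar = induced (smst_graph I i) Vbar].

Definition smst_valid (R : realType) (k : nat) (I : smst R k) : Prop :=
  [/\ 0 < k,
      forall i, simple_graph (smst_graph I i),
      forall i e, e \in edges (smst_graph I i) -> (0 <= smst_weight I e)%R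
    & exists Vbar Gbar, smst_core I Vbar Gbar].

Definition cap01 (R : realType) (k : nat) (I : smst R k) : Prop :=
  [/\ smst_valid I,
      forall i e, e \in edges (smst_graph I i) ->
        smst_weight I e = 0%R \/ smst_weight I e = 1%R
    & exists Vbar Gbar, smst_core I Vbar Gbar /\
        forall i e, e \in edges (smst_graph I i) -> smst_weight I e = 1%R ->
          e \in edges Gbar].

Definition smst_solution (R : realType) (k : nat) (I : smst R k)
    (T : {fset edge}) : Prop :=
  T `<=` \bigcup_(i <- enum 'I_k) edges (smst_graph I i) /\
  forall i, min_spanning_tree (smst_graph I i) (smst_weight I)
              (T `&` edges (smst_graph I i)).

(* Each vertex set and each edge set is listed without repetition, in an
   arbitrary order; an edge common to several graphs is listed in each of
   them, with the same weight.  A word determines the graphs and the weights of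
   their edges. *)
Definition encodes_smst01 (R : realType) (k : nat) (s : word) (I : smst R k) :
    Prop :=
  exists (vs : 'I_k -> seq name) (es : 'I_k -> seq (name * name * bool)),
    [/\ forall i, perm_eq (vs i) (verts (smst_graph I i)),
        forall i, perm_eq [seq [fset e.1.1; e.1.2] | e <- es i]
                          (edges (smst_graph I i)),
        forall i e, e \in es i ->
          smst_weight I [fset e.1.1; e.1.2] = (if e.2 then 1 else 0)%R
      & s = enc_seq enc_wgraph [seq (vs i, es i) | i <- enum 'I_k]].

Definition cap01_smst (R : realType) (k : nat) : decision_problem := {|
  instance s := exists I : smst R k, encodes_smst01 s I /\ cap01 I;
  yes_instance s := exists I : smst R k,
    [/\ encodes_smst01 s I, cap01 I & exists T, smst_solution I T]
|}.

(* Main.v *)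
Require Import Defs.
From mathcomp Require Import all_boot all_order all_algebra.
From mathcomp Require Import finmap reals.

(** All three graphs contain a hub r and one vertex per item, the items being
    the triples and the elements of U; the edges {r, x}, x an item, have weight
    1, are common to the three graphs, and all other edges have weight 0.  The
    i-th graph also has a cap p_i joined to r and a private vertex for each
    element of the i-th ground set, and it joins each item to its owner: a
    triple to its i-th component, an element u of U to u if i = 0 and to p_i
    otherwise.  Contracting the edges of weight 0 turns the i-th graph into a
    star of bundles of parallel edges, one bundle per owner, the bundle of p_i
    consisting of loops.  Hence a common minimum spanning tree selects exactly
    one item of each nonempty bundle and no item of p_i: the graphs 1 and 2
    forbid the items from U, which force the bundles of graph 0 to be nonempty,
    so the selected triples cover U, and by counting they form a matching.

    The encoding of the three graphs is a concatenation of local rewritings of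
    the list of elements and of the list of triples.  A machine with an input
    tape and an output tape writes each piece in one sweep over the input. *)

Set Implicit Arguments.
Unset Strict Implicit.
Unset Printing Implicit Defensive.

Import Order.TTheory GRing.Theory Num.Theory.

Local Open Scope fset_scope.

(** * Acyclic edge sets *)

Lemma fset2_inj (K : choiceType) (a b c d : K) :
  [fset a; b] = [fset c; d] -> (a = c /\ b = d) \/ (a = d /\ b = c).
Proof.
move=> /fsetP h.
have := h a; have := h b; have := h c; have := h d.
rewrite !inE !eqxx !orbT /= => /predU1P hd /predU1P hc /esym/predU1P hb.
move=> /esym/predU1P[eq_a|/eqP eq_a]; [left|right]; split=> //.
  by case: hb => [|/eqP] ?; case: hd => [|/eqP] ?; congruence.
by case: hb => [|/eqP] ?; case: hc => [|/eqP] ?; congruence.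
Qed.

Lemma adjC (F : {fset edge}) x y : adj F x y = adj F y x.
Proof. by rewrite /adj fsetUC. Qed.

(* The two neighbours on a cycle of a vertex of maximal rank would be equal. *)
Lemma acyclic_ranked (F : {fset edge}) (rank : name -> nat) :
  (forall v a b, adj F v a -> adj F v b ->
     rank a <= rank v -> rank b <= rank v -> a = b) ->
  acyclic F.
Proof.
move=> F_par c c_gt2 /andP[c_cyc c_uniq].
have [v v_c v_max] : exists2 v, v \in c & forall a, a \in c -> rank a <= rank v.
  have: c != [::] by case: c c_gt2 {c_cyc c_uniq}.
  elim: c {c_gt2 c_cyc c_uniq} => [|a c IHc] //= _.
  have [->|/IHc[v v_c v_max]] := eqVneq c [::].
    by exists a; rewrite ?mem_head // => b; rewrite inE => /eqP ->.
  have [le_va|/ltnW le_av] := leqP (rank v) (rank a).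
    exists a; rewrite ?mem_head // => b; rewrite inE => /predU1P[-> //|/v_max].
    by move=> /leq_trans; apply.
  exists v; first by rewrite inE v_c orbT.
  by move=> b; rewrite inE => /predU1P[-> //|/v_max].
have [i d def_c] := rot_to v_c.
have d_max a : a \in d -> rank a <= rank v.
  by move=> a_d; rewrite v_max // -(mem_rot i) def_c inE a_d orbT.
move: c_gt2 c_cyc c_uniq.
rewrite -(size_rot i) -(rot_cycle i) -(rot_uniq i) def_c {c i def_c v_c v_max}.
case: d d_max => [|a d] //; case/lastP: d => [|d b] // d_max _ /=.
rewrite rcons_path last_rcons => /and3P[adj_va _ adj_bv].
case/and3P=> _ + _; rewrite mem_rcons inE negb_or => /andP[/eqP ne_ab _]; apply: ne_ab.
apply: (F_par v); rewrite // 1?adjC ?d_max //.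
  by rewrite mem_head.
by rewrite inE mem_rcons mem_head orbT.
Qed.

(* A cycle crosses the boundary of [S] an even number of times, but could use
   the only crossing edge [{a, b}] at most once. *)
Lemma acyclic_bridge (F : {fset edge}) (S : pred name) a b :
  acyclic F -> (forall x y, adj F x y -> S x = S y) -> S a -> ~~ S b ->
  acyclic ([fset a; b] |` F).
Proof.
move=> F_acyc F_S Sa Sb c c_gt2 /andP[c_cyc c_uniq].
have new x y : adj ([fset a; b] |` F) x y ->
    [\/ adj F x y, x = a /\ y = b | x = b /\ y = a].
  rewrite /adj in_fset1U => /predU1P[/fset2_inj[[-> ->]|[-> ->]]|->];
    by [constructor 2 | constructor 3 | constructor 1].
(* Both orientations of the new edge visit [a], so a path avoiding [a] uses old edges only and stays
   on one side of [S]. *)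
have old x d : a \notin x :: d -> path (adj ([fset a; b] |` F)) x d ->
    path (adj F) x d /\ S x = S (last x d).
  elim: d x => [|y d IHd] x //; rewrite inE negb_or => /andP[ax ayd] /=.
  case/andP=> /new[xy|[xa _]|[_ ya]] /(IHd _ ayd)[-> <-].
  - by rewrite xy (F_S _ _ xy).
  - by rewrite xa eqxx in ax.
  - by rewrite ya mem_head in ayd.
have [a_c|a_nc] := boolP (a \in c); last first.
  apply: (F_acyc c c_gt2); apply/andP; split=> //.
  case: c a_nc c_cyc {c_gt2 c_uniq} => // x c xc; rewrite /= !rcons_path.
  case/andP=> /old[] // -> _ /= /new[-> //|[la _]|[_ xa]].
    by rewrite -la mem_last in xc.
  by rewrite xa mem_head in xc.
have [i d def_c] := rot_to a_c.
move: c_gt2 c_cyc c_uniq.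
rewrite -(size_rot i) -(rot_cycle i) -(rot_uniq i) def_c {c i def_c a_c}.
case: d => [|x d] // d_gt1 /=; rewrite rcons_path => /andP[ax /andP[xd da]].
move=> /andP[a_xd xd_uniq].
have [xdF Sxd] := old _ _ a_xd xd.
(* The cycle is split by its two edges at [a]. Two old edges give a cycle of [F]; one old and one
   new edge put [a] and [b] on the same side of [S]; two new edges make [b] occur twice. *)
have /new[dF|[la _]|[lb _]] := da.
- have /new[aF|[_ xb]|[ab _]] := ax.
  + apply: (F_acyc [:: a, x & d]) => //; rewrite /ucycle /= a_xd xd_uniq.
    by rewrite rcons_path aF xdF dF.
  + by move: Sb; rewrite -xb Sxd (F_S _ _ dF) Sa.
  + by rewrite -ab Sa in Sb.
- by rewrite -la mem_last in a_xd.
- have /new[aF|[_ xb]|[ab _]] := ax.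
  + by move: Sb; rewrite -lb -Sxd -(F_S _ _ aF) Sa.
  + case/lastP: d d_gt1 lb xd_uniq {xd da a_xd xdF Sxd} => // d y _.
    rewrite last_rcons xb => -> /andP[].
    by rewrite mem_rcons mem_head.
  + by rewrite -ab Sa in Sb.
Qed.

(** * Minimum spanning trees of one graph *)

Section StarGraph.

Variables (K : choiceType) (X : {fset K}) (nu gam : K -> name) (r p : name).
Hypotheses (nu_inj : injective nu) (nu_r : forall x, nu x != r).
Hypotheses (nu_p : forall x, nu x != p) (rp : r != p).
Hypotheses (gam_r : forall x, gam x != r) (gam_nu : forall x y, gam x != nu y).

(** In the application [nu] is [item_name], [gam] is [owner i], [r] is the hub and [p] is
    [cap i]. *)
Definition spoke (x : K) : edge := [fset r; nu x].
Definition twig (x : K) : edge := [fset gam x; nu x].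

Variables (G : graph) (R : realType) (w : edge -> R).
Hypothesis G_edges : forall e, e \in edges G <->
  [\/ e = [fset p; r], (exists2 x, x \in X & e = spoke x)
    | exists2 x, x \in X & e = twig x].
Hypotheses (w_root : w [fset p; r] = 0%R).
Hypotheses (w_spoke : forall x, x \in X -> w (spoke x) = 1%R).
Hypotheses (w_twig : forall x, x \in X -> w (twig x) = 0%R).

Definition selected (F : {fset edge}) : {fset K} := [fset x in X | spoke x \in F].

(** A transversal of the bundles. Removing [p] in the last clause both forbids items owned by [p]
    and requires an item for every other owner that occurs. *)
Definition representatives (S : {fset K}) : Prop :=
  [/\ S `<=` X, {in S &, injective gam}
    & [fset gam x | x in S] = [fset gam x | x in X] `\ p].

Lemma selected_sub F : selected F `<=` X.
Proof. by apply/fsubsetP=> x; rewrite !inE => /andP[]. Qed.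

Lemma spoke_inj : injective spoke.
Proof.
move=> x y /fset2_inj[[_ /nu_inj //]|[ry _]].
by have := nu_r y; rewrite -ry eqxx.
Qed.

Lemma spoke_twig x y : spoke x <> twig y.
Proof.
move=> /fset2_inj[[e _]|[e _]].
  by have := gam_r y; rewrite -e eqxx.
by have := nu_r y; rewrite -e eqxx.
Qed.

Lemma spoke_root x : spoke x <> [fset p; r].
Proof.
move=> /fset2_inj[[e _]|[_ e]]; first by have := rp; rewrite e eqxx.
by have := nu_p x; rewrite -e eqxx.
Qed.

Lemma twig_root x : twig x <> [fset p; r].
Proof.
move=> /fset2_inj[[_ e]|[_ e]].
  by have := nu_r x; rewrite e eqxx.
by have := nu_p x; rewrite e eqxx.
Qed.

Lemma twig_inj : injective twig.
Proof.
move=> x y /fset2_inj[[_ /nu_inj //]|[e _]].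
by have := gam_nu x y; rewrite e eqxx.
Qed.

(** Only spokes carry weight, so comparing trees amounts to counting their selected items. *)
Lemma total_weight_selected F :
  F `<=` edges G -> total_weight w F = #|` selected F|%:R%R.
Proof.
move=> F_E; rewrite /total_weight.
have S_F : [fset spoke x | x in selected F] `<=` F.
  by apply/fsubsetP=> e /imfsetP[x /=]; rewrite !inE => /andP[_ ? ->].
rewrite -(big_fset_incl _ S_F) => [|e eF e_nS] /=.
  rewrite big_imfset /= => [|x y _ _ /spoke_inj //].
  rewrite (eq_big_seq (fun=> 1%R)) => [|x]; last first.
    by move=> /(fsubsetP (selected_sub F)) /w_spoke.
  by rewrite big_const_seq count_predT iter_addr addr0.
have /G_edges[->//|[x xX def_e]|[x xX ->]] := fsubsetP F_E _ eF; last exact: w_twig.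
case/imfsetP: e_nS; exists x => //=.
by rewrite !inE -def_e eF xX.
Qed.

(* Otherwise [spoke x] would be the only edge of [spoke x |` T] leaving the
   bundle of [gam x], so that it could be added to [T]. *)
Lemma spanning_tree_spoke T x :
  spanning_tree G T -> x \in X -> gam x != p ->
  exists2 y, y \in selected T & gam y = gam x.
Proof.
case=> T_E T_acyc T_max xX gxp.
have [/existsP[y /eqP gy]|no_y] := boolP [exists y : selected T, gam (val y) == gam x].
  by exists (val y); rewrite ?(valP y).
have no y : y \in X -> spoke y \in T -> gam y != gam x.
  move=> yX yT; apply: contra no_y => gy; apply/existsP.
  have yS : y \in selected T by rewrite !inE yX yT.
  by exists [` yS].
(* The bundle of [gam x]: this owner together with its items. As [gam x != p], both ends of the edge
   between [p] and [r] lie outside. *)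
pose C := [pred v | (v == gam x) || (v \in [fset nu y | y in X & gam y == gam x])].
have Cnu y : y \in X -> C (nu y) = (gam y == gam x).
  move=> yX; rewrite /= [_ == gam x]eq_sym (negPf (gam_nu _ _)) /=.
  apply/imfsetP/idP => [[z /=]|gy]; last by exists y; rewrite //= !inE yX.
  by rewrite !inE => /andP[_ gz] /nu_inj ->.
have Cr : C r = false.
  rewrite /= eq_sym (negPf (gam_r _)) /=; apply/imfsetP=> -[z _ e].
  by have := nu_r z; rewrite -e eqxx.
have Cp : C p = false.
  rewrite /= eq_sym (negPf gxp) /=; apply/imfsetP=> -[z _ e].
  by have := nu_p z; rewrite -e eqxx.
have Cgam y : C (gam y) = (gam y == gam x).
  rewrite /=; case: eqP => //= _; apply/imfsetP=> -[z _ e].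
  by have := gam_nu y z; rewrite -e eqxx.
have : acyclic ([fset nu x; r] |` T).
  apply: (@acyclic_bridge _ C); rewrite ?Cnu ?Cr ?eqxx //.
  move=> a b ab; have /G_edges[/fset2_inj|[y yX e]|[y yX /fset2_inj]] := fsubsetP T_E _ ab.
  - by case=> -[-> ->]; rewrite Cr Cp.
  - have yT : spoke y \in T by rewrite -e.
    by case/fset2_inj: e => -[-> ->]; rewrite Cr Cnu // (negPf (no _ yX yT)).
  - by case=> -[-> ->]; rewrite Cgam Cnu.
move=> /T_max -/(_ _ (fsubsetU1 _ _)) eqT.
have rx_E : [fset nu x; r] |` T `<=` edges G.
  apply/fsubsetP=> e; rewrite in_fset1U => /predU1P[->|/(fsubsetP T_E) //].
  by apply/G_edges; constructor 2; exists x => //; rewrite /spoke fsetUC.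
exists x => //; rewrite !inE xX /= /spoke fsetUC -(eqT rx_E).
by rewrite in_fset1U eqxx.
Qed.

Section Tree.

Variable F : {fset edge}.
Hypotheses (F_E : F `<=` edges G) (F_root : [fset p; r] \in F).
Hypotheses (F_twig : forall x, x \in X -> twig x \in F).
Hypothesis F_trans : representatives (selected F).

Let S := selected F.

(** Along the tree towards the hub the ranks decrease: an unselected item (3) leads to its owner
    (2), an owner other than [p] to its selected item (1), a selected item to the hub (0). The rank
    of [p] is 2 as well, since it is joined to the hub directly and all its items are unselected. *)
Let rank v : nat :=
  if v == r then 0
  else if v \in [fset nu x | x in S] then 1
  else if v \in [fset nu x | x in X] then 3 else 2.

Let rank_nu x : x \in X -> rank (nu x) = if x \in S then 1 else 3.
Proof.
move=> xX; rewrite /rank (negPf (nu_r x)).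
by rewrite !(mem_imfset _ _ nu_inj) /= xX.
Qed.

Let rank_aux v : v != r -> (forall x, v != nu x) -> rank v = 2.
Proof.
move=> vr vnu; rewrite /rank (negPf vr).
have no (Y : {fset K}) : v \in [fset nu x | x in Y] = false.
  by apply/imfsetP=> -[x _ e]; have := vnu x; rewrite e eqxx.
by rewrite !no.
Qed.

Lemma representatives_acyclic : acyclic F.
Proof.
have [_ S_inj gamS] := F_trans.
have gamS_p x : x \in S -> gam x != p.
  move=> xS; have : gam x \in [fset gam x | x in S] by apply/imfsetP; exists x.
  by rewrite gamS !inE => /andP[].
have Sspoke x : x \in X -> spoke x \in F -> x \in S.
  by move=> xX xF; rewrite !inE xX.
have rank_p : rank p = 2.
  by apply: rank_aux => [|x]; rewrite eq_sym.
have rank_gam x : rank (gam x) = 2 by apply: rank_aux.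
have rank_r : rank r = 0 by rewrite /rank eqxx.
have lower v a : adj F v a -> rank a <= rank v ->
    [\/ v = p /\ a = r, exists2 x, x \in S & v = nu x /\ a = r,
        exists2 x, x \in S & v = gam x /\ a = nu x
      | exists2 x, x \in X `\` S & v = nu x /\ a = gam x].
  move=> va; have /G_edges[/fset2_inj|[x xX e]|[x xX /fset2_inj]] := fsubsetP F_E _ va.
  - by case=> -[-> ->]; rewrite ?rank_r ?rank_p // => _; constructor 1.
  - have xS : x \in S by apply: Sspoke => //; rewrite -e.
    case/fset2_inj: e => -[-> ->]; rewrite rank_r rank_nu // xS // => _.
    by constructor 2; exists x.
  - case=> -[-> ->]; rewrite rank_gam rank_nu //; case: ifPn => // xS _.
      by constructor 3; exists x.
    by constructor 4; exists x; rewrite // in_fsetD xX andbT.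
apply: (acyclic_ranked (rank := rank)) => v a b /lower va /lower vb.
move=> /va {}va /vb {}vb.
(* Mixed cases contradict the distinctness of the vertices or the disjointness of selected and
   unselected items. Representativity enters in two ways: [p] owns no selected item, and no owner
   has two of them. *)
case: va => [[vp ->]|[x xS [vx ->]]|[x xS [vx ->]]|[x xS [vx ->]]];
case: vb => [[vp' ->]|[y yS [vy ->]]|[y yS [vy ->]]|[y yS [vy ->]]] //; subst v.
- by have := gamS_p y yS; rewrite -vy eqxx.
- by have := nu_p y; rewrite -vy eqxx.
- by have := gam_nu y x; rewrite -vy eqxx.
- by move/nu_inj: vy yS => <-; rewrite in_fsetD xS.
- by have := gamS_p x xS; rewrite vp' eqxx.
- by have := gam_nu x y; rewrite vy eqxx.
- by congr nu; apply: S_inj.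
- by have := gam_nu x y; rewrite vy eqxx.
- by have := nu_p x; rewrite vp' eqxx.
- by move/nu_inj: vy xS => ->; rewrite in_fsetD yS.
- by have := gam_nu y x; rewrite -vy eqxx.
- by move/nu_inj: vy => <-.
Qed.

(** For maximality, only spokes of unselected items are missing, and each closes a cycle: a triangle
    through [p] if [p] owns the item, otherwise a 4-cycle through the owner and its selected
    item. *)
Lemma representatives_spanning_tree : spanning_tree G F.
Proof.
split=> // [|F' F'_E F'_acyc FF']; first exact: representatives_acyclic.
have [S_X _ gamS] := F_trans.
apply/eqP; rewrite eqEfsubset FF' andbT; apply/fsubsetP=> e eF'.
have /G_edges[->//|[x xX e_x]|[x xX ->]] := fsubsetP F'_E _ eF'; last exact: F_twig.
apply: contraT => eF.
have r_nu z : r == nu z = false by rewrite eq_sym; apply/negbTE.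
have nu_gam z y : nu z == gam y = false by rewrite eq_sym; apply/negbTE.
have [gx_p|gx_p] := eqVneq (gam x) p.
  case: (F'_acyc [:: r; nu x; p]) => //; rewrite /ucycle /= andbT.
  rewrite /adj !inE -/(spoke x) -e_x eF' fsetUC -gx_p -/(twig x) gx_p.
  by rewrite !(fsubsetP FF') ?F_twig //= r_nu (negPf rp) nu_p.
have : gam x \in [fset gam x | x in selected F].
  by rewrite gamS !inE gx_p; apply/imfsetP; exists x.
case/imfsetP=> y /= yS gxy; have yX := fsubsetP S_X _ yS.
have y_x : x != y.
  apply: contraNneq eF => xy; move: yS; rewrite -xy !inE => /andP[_].
  by rewrite e_x.
case: (F'_acyc [:: r; nu x; gam x; nu y]) => //.
rewrite /ucycle /= andbT /adj !inE -/(spoke x) -e_x eF'.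
rewrite [[fset nu x; _]]fsetUC -/(twig x) gxy -/(twig y).
rewrite [[fset nu y; _]]fsetUC -/(spoke y) !(fsubsetP FF') ?F_twig //=.
  rewrite !r_nu nu_gam eq_sym (negPf (gam_r _)) /= (inj_eq nu_inj) (negPf y_x).
  by rewrite gam_nu.
by move: yS; rewrite !inE => /andP[].
Qed.

End Tree.

(** This gives the lower bound on the weight: a spanning tree needs at least one spoke for each
    owner other than [p]. *)
Lemma selected_card T : spanning_tree G T ->
  [fset gam x | x in X] `\ p `<=` [fset gam x | x in selected T].
Proof.
move=> T_tree; apply/fsubsetP=> q; rewrite !inE => /andP[qp /imfsetP[x /= xX q_x]].
have [|y yS gy] := spanning_tree_spoke T_tree xX; first by rewrite -q_x.
by apply/imfsetP; exists y => //; rewrite gy.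
Qed.

Lemma representatives_min_spanning_tree F :
  F `<=` edges G -> [fset p; r] \in F -> (forall x, x \in X -> twig x \in F) ->
  representatives (selected F) -> min_spanning_tree G w F.
Proof.
move=> F_E F_root F_twig F_trans; split.
  exact: representatives_spanning_tree.
move=> T T_tree; have [T_E _ _] := T_tree.
rewrite !total_weight_selected // ler_nat.
have [_ S_inj gamS] := F_trans.
rewrite -(eqP (introT (card_in_imfsetP gam (selected F)) S_inj)) gamS.
apply: leq_trans (fsubset_leq_card (selected_card T_tree)) _.
exact: leq_imfset_card.
Qed.

Lemma representatives_exists : exists S, representatives S.
Proof.
have pick_q q : q \in [fset gam x | x in X] `\ p -> exists x, (x \in X) && (gam x == q).
  by rewrite !inE => /andP[_ /imfsetP[x xX ->]]; exists x; rewrite eqxx andbT.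
pose Q := [fset gam x | x in X] `\ p.
pose pick (q : Q) : K := xchoose (pick_q (val q) (valP q)).
have pickP q : pick q \in X /\ gam (pick q) = val q.
  by have /andP[? /eqP] := xchooseP (pick_q (val q) (valP q)).
exists [fset pick q | q : Q]; split.
- by apply/fsubsetP=> _ /imfsetP[q _ ->]; have [] := pickP q.
- move=> _ _ /imfsetP[q _ ->] /imfsetP[q' _ ->].
  by rewrite !(pickP _).2 => /val_inj ->.
- apply/fsetP=> q; apply/imfsetP/idP => [[_ /imfsetP[q' _ ->] ->]|qQ].
    by rewrite (pickP _).2; apply: valP.
  exists (pick [` qQ]); last by rewrite (pickP _).2.
  by apply/imfsetP; exists [` qQ].
Qed.

(** The tree [F0], which drops exactly the spokes outside a system of representatives [S], attains
    the lower bound. A minimum tree therefore selects at most as many items as there are owners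
    other than [p], while it covers all of these; equality of the cardinalities forces injectivity
    and the exact image. *)
Lemma min_spanning_tree_representatives F :
  min_spanning_tree G w F -> representatives (selected F).
Proof.
case=> F_tree F_min; have [F_E _ _] := F_tree.
have [S S_trans] := representatives_exists; have [S_X S_inj gamS] := S_trans.
pose F0 := edges G `\` [fset spoke x | x in X `\` S].
have F0_E : F0 `<=` edges G by apply: fsubsetDl.
have selF0 : selected F0 = S.
  apply/fsetP=> x; rewrite !inE (mem_imfset _ _ spoke_inj) /= !inE.
  case xX: (x \in X) => /=; last first.
    by symmetry; apply: contraFF xX => /(fsubsetP S_X).
  rewrite andbT negbK andb_idr // => _.
  by apply/G_edges; constructor 2; exists x.
have := F_min F0; rewrite !total_weight_selected // ler_nat selF0.
have F0_tree : spanning_tree G F0.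
  apply: representatives_spanning_tree; rewrite ?selF0 //.
    rewrite !inE; apply/andP; split; last by apply/G_edges; constructor 1.
    by apply/imfsetP=> -[x _ /esym/spoke_root].
  move=> x xX; rewrite !inE; apply/andP; split.
    by apply/imfsetP=> -[y _ /esym/spoke_twig].
  by apply/G_edges; constructor 3; exists x.
move=> /(_ F0_tree).
rewrite -(eqP (introT (card_in_imfsetP gam S) S_inj)) gamS => leFS.
have sub := selected_card F_tree.
have le_img : #|` [fset gam x | x in selected F]| <= #|` selected F|.
  exact: leq_imfset_card.
split; first exact: selected_sub.
  apply/card_in_imfsetP; rewrite eqn_leq le_img.
  exact: leq_trans leFS (fsubset_leq_card sub).
apply/eqP; rewrite eq_sym eqEfcard sub.
exact: leq_trans le_img leFS.
Qed.

End StarGraph.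

(** * The graphs of the reduction *)

Definition item : choiceType := (name + name * name * name)%type.

(** Polymorphic because it selects a component of a triple as well as one of the three lists
    [(us, vs, ws)]. *)
Definition proj (A : Type) (i : nat) (t : A * A * A) : A :=
  match i with 0 => t.1.1 | 1 => t.1.2 | _ => t.2 end.

(** The kinds of vertices are told apart by their first two bits, the hub being the empty name. Caps
    carry the index of their graph; [elt] carries none, as the ground sets are disjoint. *)
Definition hub : name := [::].
Definition cap (i : nat) : name := [:: false, false & nseq i false].
Definition elt (y : name) : name := [:: true, true & y].

(* Self-delimiting, so that the codes of the three components of a triple can
   be concatenated. *)
Definition code (y : name) : name := flatten [seq [:: true; b] | b <- y] ++ [:: false].

Definition item_name (x : item) : name :=
  match x with
  | inl u => [:: true, false & u]
  | inr t => [:: false, true & code t.1.1 ++ code t.1.2 ++ code t.2]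
  end.

Definition owner (i : nat) (x : item) : name :=
  match x with
  | inl u => if i == 0 then elt u else cap i
  | inr t => elt (proj i t)
  end.

Lemma code_inj y y' s s' : code y ++ s = code y' ++ s' -> y = y' /\ s = s'.
Proof.
elim: y y' => [|b y IHy] [|b' y'] //=; first by case.
by case=> -> /IHy[-> ->].
Qed.

Lemma item_name_inj : injective item_name.
Proof.
case=> [u|[[u v] w]] [u'|[[u' v'] w']] //=; first by case=> ->.
case=> /code_inj[->] /code_inj[->].
by rewrite -[code w]cats0 -[code w']cats0 => /code_inj[->].
Qed.

Lemma item_name_hub x : item_name x != hub.
Proof. by case: x. Qed.

Lemma item_name_cap i x : item_name x != cap i.
Proof. by case: x. Qed.

Lemma hub_cap i : hub != cap i.
Proof. by []. Qed.

Lemma owner_hub i x : owner i x != hub.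
Proof. by case: x => [u|t] //=; case: (i == 0). Qed.

Lemma owner_item_name i x y : owner i x != item_name y.
Proof. by case: x y => [u|t] [u'|t'] //=; case: (i == 0). Qed.

Lemma elt_inj : injective elt.
Proof. by move=> y y' []. Qed.

Lemma cap_inj : injective cap.
Proof. by move=> i j /(congr1 size); rewrite /= !size_nseq => -[]. Qed.

Lemma in_tripleP x t : in_triple x t <-> exists i : 'I_3, x = proj i t.
Proof.
split=> [[->|->|->]|[[[|[|[|//]]] lt_i] ->]].
- by exists (@Ordinal 3 0 isT).
- by exists (@Ordinal 3 1 isT).
- by exists (@Ordinal 3 2 isT).
- by constructor 1.
- by constructor 2.
- by constructor 3.
Qed.

Definition items (us : seq name) (ts : seq (name * name * name)) : seq item :=
  map inl us ++ map inr ts.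

Definition vert_list (us L : seq name) (ts : seq (name * name * name)) (i : nat) :
    seq name :=
  [:: hub, cap i & map elt L ++ map item_name (items us ts)].

Definition edge_list (us : seq name) (ts : seq (name * name * name)) (i : nat) :
    seq (name * name * bool) :=
  (cap i, hub, false) ::
  [seq (hub, item_name x, true) | x <- items us ts] ++
  [seq (owner i x, item_name x, false) | x <- items us ts].

Definition ends (e : name * name * bool) : edge := [fset e.1.1; e.1.2].

Section Instance.

Variables (I : tdm) (us vs ws : seq name) (ts : seq (name * name * name)).
Hypotheses (usE : perm_eq us (tdmU I)) (vsE : perm_eq vs (tdmV I)).
Hypotheses (wsE : perm_eq ws (tdmW I)) (tsE : perm_eq ts (tdmT I)).
Hypothesis I_valid : tdm_valid I.

Let lists := (us, vs, ws).
Let X : {fset item} := [fset x in items us ts].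

Lemma mem_items x :
  (x \in X) = match x with inl u => u \in tdmU I | inr t => t \in tdmT I end.
Proof.
rewrite in_fset /= /items mem_cat; case: x => x.
  rewrite mem_map ?(perm_mem usE) => [|? ? [] //].
  by apply/orb_idr=> /mapP[].
rewrite [_ \in map inr _]mem_map ?(perm_mem tsE) => [|? ? [] //].
by apply/orb_idl=> /mapP[].
Qed.

Lemma mem_proj (i : 'I_3) t : t \in tdmT I -> proj i t \in proj i lists.
Proof.
case: I_valid => _ _ _ T_sub; case: t => [[u v] w] /T_sub[uU vV wW].
case: i => [[|[|[|//]]] lt_i] /=.
- by rewrite (perm_mem usE).
- by rewrite (perm_mem vsE).
- by rewrite (perm_mem wsE).
Qed.

Lemma proj_disjoint (i j : 'I_3) y :
  y \in proj i lists -> y \in proj j lists -> i = j.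
Proof.
case: I_valid => -[/fdisjointP UV /fdisjointP UW /fdisjointP VW] _ _ _.
move=> yi yj; apply: val_inj; move: yi yj.
case: i j => [[|[|[|//]]] lt_i] [[|[|[|//]]] lt_j] //=;
rewrite ?(perm_mem usE) ?(perm_mem vsE) ?(perm_mem wsE) => yi yj;
by [have := UV _ yi; rewrite yj | have := UW _ yi; rewrite yj
  | have := VW _ yi; rewrite yj | have := UV _ yj; rewrite yi
  | have := UW _ yj; rewrite yi | have := VW _ yj; rewrite yi].
Qed.

Lemma proj_card (i : 'I_3) : size (proj i lists) = #|` tdmU I|.
Proof.
case: I_valid => _ UV UW _.
case: i => [[|[|[|//]]] lt_i] /=.
- exact: perm_size.
- by rewrite UV; apply: perm_size.
- by rewrite UW; apply: perm_size.
Qed.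

Lemma proj_uniq (i : 'I_3) : uniq (proj i lists).
Proof.
by case: i => [[|[|[|//]]] lt_i] /=;
  rewrite (perm_uniq usE, perm_uniq vsE, perm_uniq wsE) fset_uniq.
Qed.

Lemma mem_ground x : (x \in tdmU I `|` tdmV I `|` tdmW I) =
  [exists i : 'I_3, x \in proj i lists].
Proof.
rewrite !in_fsetU -(perm_mem usE) -(perm_mem vsE) -(perm_mem wsE).
apply/idP/existsP => [/orP[/orP[]|] ?|[[[|[|[|//]]] lt_i] /= ->]];
  rewrite ?orbT //.
- by exists (@Ordinal 3 0 isT).
- by exists (@Ordinal 3 1 isT).
- by exists (@Ordinal 3 2 isT).
Qed.

Definition is_representatives (S : {fset item}) : Prop :=
  forall i : 'I_3, representatives X (owner i) (cap i) S.

Lemma representatives_matching S : is_representatives S -> has_3d_matching I.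
Proof.
move=> S_tr.
have S_X x : x \in S -> x \in X by have [/fsubsetP + _ _] := S_tr ord0; apply.
(* In the graph of index 1 the items from U are owned by the cap, which has no selected item. *)
have S_inl u : inl u \notin S.
  apply/negP=> uS; have [_ _ imS] := S_tr (@Ordinal 3 1 isT).
  have : owner 1 (inl u) \in [fset owner 1 x | x in S] by apply/imfsetP; exists (inl u).
  by rewrite imS !inE eqxx.
pose M := [fset t in tdmT I | inr t \in S].
have M_inj (i : 'I_3) : {in M &, injective (proj i)}.
  move=> t t'; rewrite !inE => /andP[_ tS] /andP[_ t'S] tt'.
  have [_ S_inj _] := S_tr i; suff [] : inr t = inr t' :> item by [].
  by apply: S_inj; rewrite //= tt'.
have M_T t : t \in M -> t \in tdmT I by rewrite !inE => /andP[].
have M_U : [fset proj 0 t | t in M] = tdmU I.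
  apply/fsetP=> u; apply/imfsetP/idP => [[t /= tM ->]|uU].
    by have := mem_proj ord0 (M_T _ tM); rewrite /= (perm_mem usE).
  have [_ _ imS] := S_tr ord0.
  have : elt u \in [fset owner 0 x | x in S].
    by rewrite imS !inE; apply/imfsetP; exists (inl u); rewrite //= mem_items.
  case/imfsetP=> -[u'|t] /= xS /elt_inj ->; first by have := S_inl u'; rewrite xS.
  exists t => //; rewrite !inE xS andbT.
  by have := S_X _ xS; rewrite mem_items.
have M_card : #|` M| = #|` tdmU I|.
  by rewrite -M_U (eqP (introT (card_in_imfsetP _ _) (M_inj ord0))).
(* An element of V or W lying in no triple has an empty bundle, so the representatives alone do not
   cover it. Counting does: [proj i] maps [M] injectively into a set with as many elements as
   [M]. *)
have M_onto (i : 'I_3) y : y \in proj i lists -> exists2 t, t \in M & y = proj i t.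
  move=> yL.
  have im_sub : [fset proj i t | t in M] `<=` [fset x in proj i lists].
    apply/fsubsetP=> _ /imfsetP[t /= tM ->].
    by rewrite in_fset /=; apply: mem_proj; apply: M_T.
  have im_card : #|` [fset proj i t | t in M]| = #|` [fset x in proj i lists]|.
    rewrite (eqP (introT (card_in_imfsetP _ _) (M_inj i))) M_card -(proj_card i).
    by rewrite card_fseq undup_id ?proj_uniq.
  have : y \in [fset x in proj i lists] by rewrite in_fset.
  rewrite -(elimT (fsubset_cardP im_card) im_sub) => /imfsetP[t tM ->].
  by exists t.
exists M; split=> //; first by apply/fsubsetP.
move=> x; rewrite mem_ground => /existsP[i xi].
have [t tM x_t] := M_onto i x xi.
exists t; split=> [|t' [t'M /in_tripleP[j x_t']]].
  by split=> //; apply/in_tripleP; exists i.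
have ij : i = j.
  by apply: (proj_disjoint xi); rewrite x_t'; apply: mem_proj; apply: M_T.
by apply: (M_inj i) => //; rewrite -x_t x_t' ij.
Qed.

(** The triples of the matching serve as representatives: an owner other than the cap is [elt y] for
    some [y] of the i-th ground set, and exactly one triple of the matching contains [y]. *)
Lemma matching_representatives :
  has_3d_matching I -> exists S, is_representatives S.
Proof.
case=> M [/fsubsetP M_T _ M_ex].
have M_proj (i : 'I_3) y : y \in proj i lists ->
    exists2 t, t \in M /\ y = proj i t & forall t', t' \in M -> y = proj i t' -> t = t'.
  move=> yi; have [|t [[tM /in_tripleP[j yj]] t_uniq]] := M_ex y.
    by rewrite mem_ground; apply/existsP; exists i.
  have ij : i = j.
    by apply: (proj_disjoint yi); rewrite yj; apply: mem_proj; apply: M_T.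
  exists t; first by rewrite ij.
  by move=> t' t'M yt'; apply: t_uniq; split=> //; apply/in_tripleP; exists i.
exists [fset (inr t : item) | t in M] => i; split.
- by apply/fsubsetP=> _ /imfsetP[t /= /M_T tT ->]; rewrite mem_items.
- move=> _ _ /imfsetP[t /= tM ->] /imfsetP[t' /= t'M ->] /elt_inj tt'.
  have [t0 _ t0_uniq] := M_proj i _ (mem_proj i (M_T _ tM)).
  by rewrite -(t0_uniq _ tM) // -(t0_uniq _ t'M).
- apply/fsetP=> q; rewrite !inE; apply/imfsetP/andP=> [[_ /imfsetP[t /= tM ->] ->]|].
    split=> //; apply/imfsetP; exists (inr t) => //=.
    by rewrite mem_items; apply: M_T.
  case=> q_cap /imfsetP[x /= xX q_x].
  have [y yi q_y] : exists2 y, y \in proj i lists & q = elt y.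
    move: q_cap xX; rewrite q_x mem_items; case: x {q_x} => [u|t] /=.
      case: (nat_of_ord i =P 0) => [-> _ uU|_]; last by rewrite eqxx.
      by exists u; rewrite //= (perm_mem usE).
    by move=> _ tT; exists (proj i t) => //; apply: mem_proj.
  have [t [tM y_t] _] := M_proj i y yi.
  exists (inr t); last by rewrite q_y y_t.
  by apply/imfsetP; exists t.
Qed.

Let vl (i : 'I_3) := vert_list us (proj i lists) ts i.
Let el (i : 'I_3) := edge_list us ts i.
Let spk := spoke item_name hub.
Let twg i := twig item_name (owner i).

Lemma edge_listP (i : 'I_3) e : e \in map ends (el i) <->
  [\/ e = [fset cap i; hub], (exists2 x, x \in X & e = spk x)
    | exists2 x, x \in X & e = twg i x].
Proof.
rewrite /el /edge_list map_cons in_cons map_cat mem_cat -!map_comp.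
split=> [/predU1P[->|/orP[]/mapP[x xX ->]]|[->|[x xX ->]|[x xX ->]]].
- by constructor 1.
- by constructor 2; exists x; rewrite // in_fset.
- by constructor 3; exists x; rewrite // in_fset.
- by rewrite eqxx.
- apply/orP; right; apply/orP; left; apply/mapP.
  by exists x => //; move: xX; rewrite in_fset.
- apply/orP; right; apply/orP; right; apply/mapP.
  by exists x => //; move: xX; rewrite in_fset.
Qed.

Lemma items_uniq : uniq (items us ts).
Proof.
rewrite cat_uniq !map_inj_uniq => [|? ? [] //|? ? [] //].
rewrite (perm_uniq usE) (perm_uniq tsE) !fset_uniq /= andbT.
by apply/hasPn=> _ /mapP[t _ ->]; apply/mapP=> -[].
Qed.

Lemma edge_list_uniq (i : 'I_3) : uniq (map ends (el i)).
Proof.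
have spk_inj : injective spk.
  exact: (spoke_inj item_name_inj item_name_hub).
have twg_inj : injective (twg i).
  exact: (twig_inj item_name_inj (owner_item_name i)).
rewrite /el /edge_list map_cons map_cat -!map_comp cons_uniq cat_uniq.
rewrite [uniq (map (ends \o _) _)](map_inj_uniq spk_inj).
rewrite [X in _ && (_ && (_ && X))](map_inj_uniq twg_inj) items_uniq /= andbT.
apply/andP; split.
  rewrite mem_cat negb_or; apply/andP; split; apply/mapP=> -[x _ /esym].
    exact: (spoke_root (item_name_cap i) (hub_cap i)).
  exact: (twig_root (item_name_hub) (item_name_cap i)).
apply/hasPn=> _ /mapP[y _ ->]; apply/mapP=> -[x _ /esym].
exact: (spoke_twig item_name_hub (owner_hub i)).
Qed.

Lemma vert_list_uniq (i : 'I_3) : uniq (vl i).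
Proof.
rewrite /vl /vert_list !cons_uniq in_cons mem_cat !negb_or cat_uniq.
rewrite (map_inj_uniq elt_inj) (map_inj_uniq item_name_inj) proj_uniq items_uniq.
rewrite andbT /= -!andbA; apply/and4P; split.
- by apply/mapP=> -[y _].
- by apply/mapP=> -[x _ e]; have := item_name_hub x; rewrite -e.
- rewrite mem_cat negb_or; apply/andP; split; apply/mapP=> -[x _ e] //.
  by have := item_name_cap i x; rewrite -e eqxx.
- apply/hasPn=> _ /mapP[x _ ->]; apply/mapP=> -[y _].
  by case: x.
Qed.

(** * Arbitrary problem instances with the listed edges and weights *)

Section Encoded.

Variables (R : realType) (J : smst R 3).
Hypothesis J_edges : forall i, edges (smst_graph J i) =i map ends (el i).
Hypothesis J_weight : forall i e, e \in el i ->
  smst_weight J (ends e) = (if e.2 then 1 else 0)%R.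

Let J_edgesP i e : e \in edges (smst_graph J i) <->
  [\/ e = [fset cap i; hub], (exists2 x, x \in X & e = spk x)
    | exists2 x, x \in X & e = twg i x].
Proof. by rewrite J_edges; apply: edge_listP. Qed.

Let J_weight_root (i : 'I_3) : smst_weight J [fset cap i; hub] = 0%R.
Proof. by apply: (J_weight (i := i) (e := (cap i, hub, false))); rewrite mem_head. Qed.

Let J_weight_spoke x : x \in X -> smst_weight J (spk x) = 1%R.
Proof.
rewrite in_fset => /= xX; apply: (J_weight (i := ord0) (e := (hub, item_name x, true))).
by rewrite inE mem_cat (map_f (fun x => (hub, item_name x, true))) ?orbT.
Qed.

Let J_weight_twig (i : 'I_3) x : x \in X -> smst_weight J (twg i x) = 0%R.
Proof.
rewrite in_fset => /= xX; apply: (J_weight (i := i) (e := (owner i x, item_name x, false))).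
by rewrite inE mem_cat (map_f (fun x => (owner i x, item_name x, false))) ?orbT.
Qed.

(** Spokes belong to all three graphs, so a single [T] selects the same items in each of them.
    Conversely, all edges except the spokes of unselected items form a solution. *)
Lemma solution_matching : (exists T, smst_solution J T) <-> has_3d_matching I.
Proof.
split=> [[T [T_sub T_min]]|/matching_representatives[S S_rep]].
  apply: (@representatives_matching [fset x in X | spk x \in T]) => i.
  have := min_spanning_tree_representatives item_name_inj item_name_hub
    (item_name_cap i) (hub_cap i) (owner_hub i) (owner_item_name i) (J_edgesP i)
    (J_weight_root i) J_weight_spoke (J_weight_twig i) (T_min i).
  congr representatives; apply/fsetP=> x; rewrite !inE -!mem_cat -/(items us ts) /=.
  case xX: (x \in items us ts) => //=; apply: andb_idr => _.
  by apply/J_edgesP; constructor 2; exists x; rewrite // in_fset.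
pose dropped := [fset spk x | x in X `\` S].
exists ((\bigcup_(i <- enum 'I_3) edges (smst_graph J i)) `\` dropped).
split=> [|i]; first exact: fsubsetDl.
have -> : (\bigcup_(i <- enum 'I_3) edges (smst_graph J i) `\` dropped)
    `&` edges (smst_graph J i) = edges (smst_graph J i) `\` dropped.
  apply/fsetP=> e; rewrite !inE -andbA; congr andb; apply/andb_idl=> ei.
  by apply/bigfcupP; exists i; rewrite // mem_enum.
apply: (representatives_min_spanning_tree item_name_inj item_name_hub
    (item_name_cap i) (hub_cap i) (owner_hub i) (owner_item_name i) (J_edgesP i)
    (J_weight_root i) J_weight_spoke (J_weight_twig i)).
- exact: fsubsetDl.
- rewrite !inE; apply/andP; split; last by apply/J_edgesP; constructor 1.
  by apply/imfsetP=> -[x _ /esym/(spoke_root (item_name_cap i) (hub_cap i))].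
- move=> x xX; rewrite !inE; apply/andP; split; last first.
    by apply/J_edgesP; constructor 3; exists x.
  apply/imfsetP=> -[y _ /esym].
  exact: (spoke_twig item_name_hub (owner_hub i)).
- suff -> : selected X item_name hub (edges (smst_graph J i) `\` dropped) = S.
    exact: S_rep.
  have [/fsubsetP S_X _ _] := S_rep i.
  have spk_inj := spoke_inj item_name_inj item_name_hub.
  apply/fsetP=> x; rewrite /selected in_fset inE /= -/X -/(spk x) in_fsetD.
  rewrite (mem_imfset _ _ spk_inj) /= in_fsetD.
  case xX: (x \in X) => /=; last by symmetry; apply: contraFF xX => /S_X.
  rewrite andbT negbK andb_idr // => _.
  by apply/J_edgesP; constructor 2; exists x.
Qed.

Hypothesis J_verts : forall i, verts (smst_graph J i) =i vl i.

Let core_verts : {fset name} := hub |` [fset item_name x | x in X].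
Let core : graph := Graph core_verts [fset spk x | x in X].

Lemma encoded_simple i : simple_graph (smst_graph J i).
Proof.
have card2 (a b : name) : a != b -> #|` [fset a; b]| = 2.
  by move=> ab; rewrite cardfs2 ab.
have item_vert x : x \in X -> item_name x \in verts (smst_graph J i).
  rewrite in_fset => /= xX; rewrite J_verts /vl /vert_list !in_cons mem_cat.
  by rewrite (map_f item_name xX) !orbT.
have root_vert : hub \in verts (smst_graph J i) by rewrite J_verts mem_head.
have cap_vert : cap i \in verts (smst_graph J i).
  by rewrite J_verts /vl /vert_list !in_cons eqxx orbT.
have elt_vert y : y \in proj i lists -> elt y \in verts (smst_graph J i).
  move=> yi; rewrite J_verts /vl /vert_list !in_cons mem_cat.
  by rewrite (map_f elt yi) !orbT.
move=> e /J_edgesP[->|[x xX ->]|[x xX ->]]; rewrite fsubUset !fsub1set.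
- by rewrite root_vert cap_vert card2.
- by rewrite root_vert item_vert // card2 // eq_sym item_name_hub.
- rewrite item_vert // card2 ?owner_item_name // andbT; split=> //.
  move: xX; rewrite mem_items; case: x => [u uU|t tT] /=.
    case: (nat_of_ord i =P 0) => // i0.
    by apply: elt_vert; rewrite i0 (perm_mem usE).
  by apply: elt_vert; apply: mem_proj.
Qed.

(** Two different graphs share only the hub and the items, since caps are indexed and the ground
    sets are disjoint. A root edge contains a cap and a twig contains an owner, so only spokes are
    induced on the core. *)
Lemma encoded_core : smst_core J core_verts core.
Proof.
have sub i v : v \in core_verts -> v \in verts (smst_graph J i).
  rewrite J_verts /vl /vert_list in_fset1U => /predU1P[->|]; first by rewrite mem_head.
  case/imfsetP=> x /=; rewrite in_fset /= => xX ->.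
  by rewrite !in_cons mem_cat (map_f item_name xX) !orbT.
have core_cap i : cap i \notin core_verts.
  rewrite in_fset1U /=; apply/imfsetP=> -[x _ e].
  by have := item_name_cap i x; rewrite e eqxx.
have core_elt y : elt y \notin core_verts.
  by rewrite in_fset1U /=; apply/imfsetP=> -[[]].
split=> [i|i j ij|i]; first by apply/fsubsetP=> v; apply: sub.
  apply/fsetP=> v; rewrite in_fsetI; apply/idP/andP=> [v_core|]; first by rewrite !sub.
  rewrite !J_verts /vl /vert_list !in_cons !mem_cat.
  have old z : z \in map item_name (items us ts) -> z \in core_verts.
    case/mapP=> x xX ->; rewrite in_fset1U; apply/orP; right.
    by apply/imfsetP; exists x; rewrite //= in_fset.
  case=> /predU1P[->|]; first by rewrite in_fset1U eqxx.
  case/predU1P=> [->|/orP[/mapP[y yi ->]|/old //]].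
    case/orP=> [//|/orP[/eqP/cap_inj/val_inj e|/orP[/mapP[] //|/old //]]].
    by rewrite e eqxx in ij.
  case/orP=> [//|/orP[//|/orP[/mapP[y' yj /elt_inj e]|/old //]]].
  by rewrite e in yi; rewrite (proj_disjoint yi yj) eqxx in ij.
congr Graph; apply/fsetP=> e; rewrite in_fset /= inE /=.
apply/imfsetP/andP=> [[x /= xX ->]|[/J_edgesP[->|[x xX ->]|[x xX ->]]]].
- split; first by apply/J_edgesP; constructor 2; exists x.
  rewrite fsubUset !fsub1set !in_fset1U eqxx /=; apply/orP; right.
  by apply/imfsetP; exists x.
- by rewrite fsubUset fsub1set (negPf (core_cap _)).
- by exists x.
- rewrite fsubUset fsub1set; case: x xX => [u|t] _ /=; last by rewrite (negPf (core_elt _)).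
  by case: ifP; rewrite ?(negPf (core_cap _)) ?(negPf (core_elt _)).
Qed.

Lemma encoded_cap01 : cap01 J.
Proof.
have weight01 i e : e \in edges (smst_graph J i) ->
    smst_weight J e = 0%R \/ smst_weight J e = 1%R.
  case/J_edgesP=> [->|[x xX ->]|[x xX ->]].
  - by left; apply: J_weight_root.
  - by right; apply: J_weight_spoke.
  - by left; apply: J_weight_twig.
split=> //; first split=> //.
- exact: encoded_simple.
- by move=> i e /weight01[] ->; rewrite ?ler01.
- by exists core_verts, core; apply: encoded_core.
exists core_verts, core; split=> [|i e]; first exact: encoded_core.
case/J_edgesP=> [->|[x xX ->] _|[x xX ->]].
- by rewrite J_weight_root => /esym/eqP; rewrite oner_eq0.
- by apply/imfsetP; exists x.
- by rewrite J_weight_twig // => /esym/eqP; rewrite oner_eq0.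
Qed.

End Encoded.

(** The weight is the indicator of the spokes; it agrees with the listed bits because a spoke is
    neither a root edge nor a twig. *)
Lemma encoded_instance (R : realType) : exists J : smst R 3,
  [/\ forall i, perm_eq (vl i) (verts (smst_graph J i)),
      forall i, perm_eq (map ends (el i)) (edges (smst_graph J i))
    & forall i e, e \in el i ->
        smst_weight J (ends e) = (if e.2 then 1 else 0)%R].
Proof.
pose weight (e : edge) : R := (if e \in [fset spk x | x in X] then 1 else 0)%R.
exists (Smst (fun i => Graph [fset v in vl i] [fset e in map ends (el i)]) weight).
split=> [i|i|i e] /=.
- by apply: uniq_perm; rewrite ?vert_list_uniq ?fset_uniq // => v; rewrite in_fset.
- by apply: uniq_perm; rewrite ?edge_list_uniq ?fset_uniq // => v; rewrite in_fset.
rewrite /weight /el /edge_list in_cons mem_cat.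
case/predU1P=> [->|/orP[]/mapP[x xX ->]] /=.
- rewrite ifF //; apply/imfsetP=> -[x _ /esym].
  exact: (spoke_root (item_name_cap i) (hub_cap i)).
- by rewrite ifT //; apply/imfsetP; exists x; rewrite //= in_fset.
- rewrite ifF //; apply/imfsetP=> -[y _ /esym].
  exact: (spoke_twig item_name_hub (owner_hub i)).
Qed.

End Instance.

(** * A structured language for two-tape machines *)

Local Close Scope fset_scope.

Definition cell : Type := option (symbol + void).
Definition tapes : Type := (tape (symbol + void) * tape (symbol + void))%type.
Definition action : Type := ((cell * direction) * (cell * direction))%type.

Definition scanned (t : tapes) : cell * cell := (cur t.1, cur t.2).

Definition act (a : action) (t : tapes) : tapes :=
  (shift a.1.2 (write a.1.1 t.1), shift a.2.2 (write a.2.1 t.2)).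

Definition stay (s : cell * cell) : action := ((s.1, Stay), (s.2, Stay)).

Inductive prog :=
| Act of (cell * cell -> action)
| Seq of prog & prog
| While of pred (cell * cell) & prog.

(** The points at which a step is still to be executed. For [While], [None] is the test and [Some] a
    point of the body; termination is added outside, by one more [option]. *)
Fixpoint control (p : prog) : finType :=
  match p with
  | Act _ => unit
  | Seq p q => (control p + control q)%type
  | While _ p => option (control p)
  end.

Fixpoint entry (p : prog) : control p :=
  match p with
  | Act _ => tt
  | Seq p q => inl (entry p)
  | While _ p => None
  end.

(** The result [None] means that the program terminates with this step. For the body of a loop it
    becomes [Some None], which is the test again. *)
Fixpoint next (p : prog) : control p -> cell * cell -> option (control p) * action :=
  match p with
  | Act f => fun _ s => (None, f s)
  | Seq p q => fun c s =>
      match c with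
      | inl c => let: (c', a) := next c s in
                 (Some (if c' is Some c' then inl c' else inr (entry q)), a)
      | inr c => let: (c', a) := next c s in (omap inr c', a)
      end
  | While b p => fun c s =>
      match c with
      | None => (if b s then Some (Some (entry p)) else None, stay s)
      | Some c => let: (c', a) := next c s in (Some c', a)
      end
  end.

(* The number of steps of a run all of whose loops are executed at most 'X
   times. *)
Fixpoint bound (p : prog) : {poly nat} :=
  match p with
  | Act _ => 1
  | Seq p q => bound p + bound q
  | While _ p => 'X * (1 + bound p) + 1
  end%R.

Definition state (p : prog) : Type := (option (control p) * tapes)%type.

Definition small_step (p : prog) (c : state p) : state p :=
  if c.1 is Some k then
    let: (k', a) := next k (scanned c.2) in (k', act a c.2)
  else c.

Definition reaches (p : prog) (n : nat) (c c' : state p) : Prop :=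
  exists2 m, m <= n & iter m (@small_step p) c = c'.

Definition runs (N : nat) (p : prog) (t t' : tapes) : Prop :=
  reaches (bound p).[N]%R (Some (entry p), t) (None, t').

Lemma act_stay t : act (stay (scanned t)) t = t.
Proof. by case: t => [[l c r] [l' c' r']]. Qed.

Lemma reaches_trans p n m (c c' c'' : state p) :
  reaches n c c' -> reaches m c' c'' -> reaches (n + m) c c''.
Proof.
case=> i le_in <- [j le_jm <-]; exists (j + i); first by rewrite addnC leq_add.
exact: iterD.
Qed.

Lemma reaches_step p n (c c' : state p) :
  reaches n (small_step c) c' -> reaches n.+1 c c'.
Proof. by case=> m le_mn <-; exists m.+1; rewrite ?iterSr. Qed.

Lemma reaches_leq p n m (c c' : state p) :
  n <= m -> reaches n c c' -> reaches m c c'.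
Proof. by move=> le_nm [i le_in <-]; exists i; rewrite // (leq_trans le_in). Qed.

Lemma halted_fixed p n t : iter n (@small_step p) (None, t) = (None, t).
Proof. by elim: n => //= n ->. Qed.

Lemma runs_act N f t : runs N (Act f) t (act (f (scanned t)) t).
Proof. by exists 1; rewrite // /= hornerC. Qed.

(** Sequencing costs no step, as the last step of [p] leads to the entry of [q]. The two time bounds
    are independent, which allows programs whose loops are bounded by different numbers. *)
Lemma reaches_seq p q n m t t' t'' :
  reaches n (Some (entry p), t) (None, t') ->
  reaches m (Some (entry q), t') (None, t'') ->
  reaches (n + m) (Some (entry (Seq p q)), t) (None, t'').
Proof.
move=> run_p run_q /=.
apply: (@reaches_trans (Seq p q) _ _ _ (Some (inr (entry q)), t')); last first.
  case: run_q => j le_j e; exists j => //.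
  pose lift (c : state q) : state (Seq p q) := (omap inr c.1, c.2).
  rewrite -[RHS]/(lift (None, t'')) -e.
  have lift_step c : small_step (lift c) = lift (small_step c).
    by case: c => [[k|] u] //; rewrite /small_step /=; case: (next k _).
  by elim: j {le_j e} => // j IHj; rewrite !iterS IHj lift_step.
case: run_p => i le_i e; apply: reaches_leq le_i _.
elim: i {1 2}(entry p) t e => [|i IHi] k u //.
rewrite iterSr => e; apply: reaches_step; move: e; rewrite /small_step /=.
case: (next k _) => -[k'|] a /=; first exact: IHi.
by rewrite halted_fixed => -[->]; exists 0.
Qed.

Lemma runs_seq N p q t t' t'' :
  runs N p t t' -> runs N q t' t'' -> runs N (Seq p q) t t''.
Proof. by rewrite /runs /= hornerD; apply: reaches_seq. Qed.

Lemma runs_while_body N (b : pred (cell * cell)) p t t' n t'' :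
  b (scanned t) -> runs N p t t' ->
  reaches n (Some (entry (While b p)), t') (None, t'') ->
  reaches (1 + (bound p).[N]%R + n) (Some (entry (While b p)), t) (None, t'').
Proof.
move=> bt [m le_m e] run; rewrite add1n addSn; apply: reaches_step.
rewrite /small_step /= bt act_stay.
apply: reaches_trans run; apply: reaches_leq le_m _.
elim: m {1 2}(entry p) t e {bt} => [|m IHm] k u //.
rewrite iterSr => e; apply: reaches_step; move: e; rewrite /small_step /=.
case: (next k _) => -[k'|] a /=; first exact: IHm.
by rewrite halted_fixed => -[->]; exists 0.
Qed.

(** A step adds at most one cell to the left of the output head. Hence the running time bounds the
    length of the output. *)
Lemma reaches_left_size p n (c c' : state p) :
  reaches n c c' -> size (left c'.2.2) <= size (left c.2.2) + n.
Proof.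
case=> m le_mn <-; apply: leq_trans (leq_add (leqnn _) le_mn).
elim: m {le_mn} => [|m IHm]; first by rewrite addn0.
rewrite iterS addnS; move: IHm; case: (iter m _ c) => k t /= IHm.
rewrite /small_step /=; case: k => [k|]; last exact: leqW.
case: (next k _) => k' [a [x d]] /=; case: d => /=.
- by rewrite size_behead; apply: leq_trans (leq_pred _) (leqW IHm).
- exact: leqW.
- exact: IHm.
Qed.

(** The number of iterations is kept apart from [N], which bounds the loops inside the body and
    stays fixed during inductions. *)
Inductive iterates (N : nat) (b : pred (cell * cell)) (p : prog) :
    nat -> tapes -> tapes -> Prop :=
| IteratesDone t : ~~ b (scanned t) -> iterates N b p 0 t t
| IteratesBody n t t' t'' : b (scanned t) -> runs N p t t' ->
    iterates N b p n t' t'' -> iterates N b p n.+1 t t''.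

Lemma runs_while N b p n t t' :
  n <= N -> iterates N b p n t t' -> runs N (While b p) t t'.
Proof.
move=> le_nN it.
have: reaches (n * (1 + (bound p).[N]%R) + 1) (Some (entry (While b p)), t) (None, t').
  elim: it {le_nN} => [{}t nbt|{}n u u' u'' bu run_u _ IH].
    apply: reaches_step; rewrite /small_step /= (negPf nbt) act_stay.
    by exists 0.
  by rewrite mulSn -addnA; apply: runs_while_body IH.
apply: reaches_leq; rewrite /= !hornerE leq_add2r leq_mul2r.
by rewrite le_nN orbT.
Qed.

(** The argument [1] is [tm_tapes], hence there are two tapes, input at [ord0] and output at
    [ord_max]. *)
Definition machine (p : prog) : turing_machine :=
  @TuringMachine (option (control p)) void 1 (Some (entry p)) (fun k => k == None)
    (fun k s =>
       if k is Some k then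
         let: (k', a) := next k (s ord0, s ord_max) in
         (k', [ffun i => if i == ord0 then a.1 else a.2])
       else (None, [ffun i => (s i, Stay)])).

Definition config_of (p : prog) (c : state p) : config (machine p) :=
  (c.1, [ffun i => if i == ord0 then c.2.1 else c.2.2]).

Lemma machine_step p (c : state p) :
  step (config_of c) = config_of (small_step c).
Proof.
case: c => [[k|] t]; rewrite /step /small_step /config_of //=.
rewrite !ffunE /=; case: (next k _) => k' a /=; congr pair.
by apply/ffunP=> i; rewrite !ffunE; case: eqP.
Qed.

Lemma machine_computes p n s t' :
  reaches n (Some (entry p), (input_tape void s, input_tape void [::])) (None, t') ->
  computes_within (machine p) n s (read (cur t'.2 :: right t'.2)).
Proof.
case=> m le_m e; rewrite /computes_within.
have -> : init (machine p) s =
    config_of (Some (entry p), (input_tape void s, input_tape void [::])).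
  by congr pair; apply/ffunP=> i; rewrite !ffunE; case: eqP.
have it k c :
    iter k (@step (machine p)) (config_of c) = config_of (iter k (@small_step p) c).
  by elim: k => //= k ->; rewrite machine_step.
rewrite it -(subnK le_m) iterD e halted_fixed /output /=.
by rewrite ffunE.
Qed.

(** * Programs that read the input and append to the output *)

Definition inS (x : symbol) : cell := Some (inl x).

(* The head is on the first symbol of [b].  The explicit blank on the left is
   there because [copier] starts with a move to the left and back, so that
   [rewind] restores exactly this tape. *)
Definition input_at (a b : word) : tape (symbol + void) :=
  Tape (map inS (rev a) ++ [:: None]) (head None (map inS b)) (behead (map inS b)).

Definition output_at (o : word) : tape (symbol + void) :=
  Tape (map inS (rev o)) None [::].

Definition tapes_at (a b o : word) : tapes := (input_at a b, output_at o).

(** The first clause says that the input word itself is preserved, so that consecutive programs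
    share the same bound on their loops. *)
Definition emits (p : prog) (a b w a' b' : word) : Prop :=
  a' ++ b' = a ++ b /\
  forall o, runs (size (a ++ b)) p (tapes_at a b o) (tapes_at a' b' (o ++ w)).

Definition on (test : pred symbol) (s : cell * cell) : bool :=
  if s.1 is Some (inl x) then test x else false.

Definition is_bit (x : symbol) : bool :=
  match x with Zero | One => true | _ => false end.
Definition is_open (x : symbol) : bool := if x is Open then true else false.

Definition skip : prog := Act stay.
Definition put (x : symbol) : prog :=
  Act (fun s => ((s.1, Stay), (inS x, MoveRight))).
Definition fwd : prog := Act (fun s => ((s.1, MoveRight), (s.2, Stay))).
Definition bwd : prog := Act (fun s => ((s.1, MoveLeft), (s.2, Stay))).
Definition copy : prog := Act (fun s => ((s.1, MoveRight), (s.1, MoveRight))).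

Definition emit (w : word) : prog := foldr (fun x => Seq (put x)) skip w.

Lemma emits_seq p q a b w a' b' w' a'' b'' :
  emits p a b w a' b' -> emits q a' b' w' a'' b'' ->
  emits (Seq p q) a b (w ++ w') a'' b''.
Proof.
case=> ab' run_p [ab'' run_q]; split=> [|o]; first by rewrite ab''.
by rewrite catA; apply: runs_seq (run_p o) _; rewrite -ab'.
Qed.

Lemma emits_act f a b w a' b' : a' ++ b' = a ++ b ->
  (forall o, act (f (scanned (tapes_at a b o))) (tapes_at a b o) =
             tapes_at a' b' (o ++ w)) ->
  emits (Act f) a b w a' b'.
Proof. by move=> ab act_f; split=> // o; rewrite -act_f; apply: runs_act. Qed.

Lemma emits_skip a b : emits skip a b [::] a b.
Proof. by apply: emits_act => // o; rewrite cats0 act_stay. Qed.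

Lemma emits_put x a b : emits (put x) a b [:: x] a b.
Proof.
by apply: emits_act => // o; rewrite /act /tapes_at /output_at rev_cat.
Qed.

Lemma emits_fwd a x b : emits fwd a (x :: b) [::] (a ++ [:: x]) b.
Proof.
apply: emits_act => [|o]; first by rewrite -catA.
by rewrite /act /tapes_at /input_at rev_cat cats0; case: b.
Qed.

Lemma emits_bwd a x y b : emits bwd (a ++ [:: x]) (y :: b) [::] a (x :: y :: b).
Proof.
apply: emits_act => [|o]; first by rewrite -catA.
by rewrite /act /tapes_at /input_at rev_cat cats0.
Qed.

Lemma emits_copy a x b : emits copy a (x :: b) [:: x] (a ++ [:: x]) b.
Proof.
apply: emits_act => [|o]; first by rewrite -catA.
by rewrite /act /tapes_at /input_at /output_at !rev_cat; case: b.
Qed.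

Lemma emits_emit w a b : emits (emit w) a b w a b.
Proof.
elim: w => [|x w IHw]; first exact: emits_skip.
exact: emits_seq (emits_put x a b) IHw.
Qed.

(** Each iteration consumes one nonempty code, so there are at most as many iterations as input
    symbols; the symbol [z] stops the loop. *)
Lemma emits_loop (A : Type) (test : pred symbol) body (enc h : A -> word) :
  (forall x, exists y w, enc x = y :: w /\ test y) ->
  (forall x a b, emits body a (enc x ++ b) (h x) (a ++ enc x) b) ->
  forall xs a z b, ~~ test z ->
  emits (While (on test) body) a (flatten (map enc xs) ++ z :: b)
    (flatten (map h xs)) (a ++ flatten (map enc xs)) (z :: b).
Proof.
move=> enc_test body_emits xs a z b z_test; split=> [|o]; first by rewrite -catA.
have le_size : size xs <= size (a ++ flatten (map enc xs) ++ z :: b).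
  rewrite !size_cat; apply: leq_trans (leq_addl _ _); apply: leq_trans (leq_addr _ _).
  elim: xs => //= x xs IHxs; rewrite size_cat.
  by have [y [w [-> _]]] := enc_test x; rewrite addSn ltnS (leq_trans IHxs) ?leq_addl.
apply: runs_while le_size _.
(* The bound is frozen as [N], since the induction moves the boundary between the read and unread
   parts. *)
move: {2}(size _) (erefl (size (a ++ flatten (map enc xs) ++ z :: b))) => N.
elim: xs a o => [|x xs IHxs] a o /= sizeN.
  by rewrite !cats0 sizeN; apply: IteratesDone.
have [e run] := body_emits x a (flatten (map enc xs) ++ z :: b).
apply: (IteratesBody _ (t' := tapes_at (a ++ enc x) (flatten (map enc xs) ++ z :: b) (o ++ h x))).
- by have [y [w [-> ]]] := enc_test x.
- by rewrite -catA; apply: run.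
- have := IHxs (a ++ enc x) (o ++ h x); rewrite -!catA => IH.
  by rewrite -catA in sizeN; apply: IH; rewrite -sizeN.
Qed.

Definition back : prog := While (on (predC is_open)) bwd.

Lemma emits_back a c z b : all (predC is_open) (rcons c z) ->
  emits back (a ++ Open :: c) (z :: b) [::] a (Open :: c ++ z :: b).
Proof.
move=> c_test; split=> [|o]; first by rewrite -catA.
(* One move for each symbol of [c] and one from there onto [Open]. *)
rewrite cats0; apply: (runs_while (n := (size c).+1)).
  by rewrite !size_cat /= -addnA addnCA leq_addr.
move sizeN: (size _) => N; elim/last_ind: c z b c_test sizeN => [|c x IHc] z b.
  rewrite /= andbT => z_test sizeN; have [_ run] := emits_bwd a Open z b.
  apply: (IteratesBody _ (t' := tapes_at a (Open :: z :: b) o)) => //.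
    by rewrite -sizeN -[X in tapes_at a _ X]cats0; apply: run.
  exact: IteratesDone.
rewrite all_rcons => /andP[z_test cx_test] sizeN.
have [_ run] := emits_bwd (a ++ Open :: c) x z b.
rewrite size_rcons -cats1 -cat_cons catA.
apply: (IteratesBody _ (t' := tapes_at (a ++ Open :: c) (x :: z :: b) o)) => //.
  rewrite -sizeN -cats1 -cat_cons catA -[X in tapes_at _ (x :: _) X]cats0.
  exact: run.
rewrite -catA; apply: IHc => //; rewrite -sizeN.
by rewrite -cats1 -!catA /= -catA.
Qed.

Lemma is_bit_bit c : is_bit (bit c).
Proof. by case: c. Qed.

Lemma all_not_open y : all (predC is_open) (map bit y).
Proof. by rewrite all_map; apply/allP=> -[]. Qed.

Lemma flatten_bits y : flatten [seq [:: bit c] | c <- y] = map bit y.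
Proof. by elim: y => //= c y ->. Qed.

Lemma bracket_cat w b : bracket w ++ b = Open :: w ++ Close :: b.
Proof. by rewrite /bracket cat_cons -catA. Qed.

Lemma enc_name_cat y b : enc_name y ++ b = Open :: map bit y ++ Close :: b.
Proof. exact: bracket_cat. Qed.

Definition scan (body : prog) : prog := Seq fwd (While (on is_bit) body).

Lemma emits_scan body (h : bool -> word) :
  (forall c a b, emits body a (bit c :: b) (h c) (a ++ [:: bit c]) b) ->
  forall y a b, emits (scan body) a (enc_name y ++ b)
    (flatten (map h y)) (a ++ Open :: map bit y) (Close :: b).
Proof.
move=> body_emits y a b.
have := @emits_loop bool is_bit body (fun c => [:: bit c]) h _ body_emits y
  (a ++ [:: Open]) Close b isT.
rewrite flatten_bits -catA => loop; rewrite enc_name_cat.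
apply: emits_seq (emits_fwd _ _ _) (loop _) => c.
by exists (bit c), [::]; rewrite is_bit_bit.
Qed.

Definition each (body : prog) : prog := Seq fwd (While (on is_open) body).

Lemma emits_each (A : Type) body (inner h : A -> word) :
  (forall x a b, emits body a (bracket (inner x) ++ b) (h x) (a ++ bracket (inner x)) b) ->
  forall xs a b, emits (each body) a (enc_seq (bracket \o inner) xs ++ b)
    (flatten (map h xs)) (a ++ Open :: flatten (map (bracket \o inner) xs)) (Close :: b).
Proof.
move=> body_emits xs a b.
have := @emits_loop A is_open body (bracket \o inner) h _ body_emits xs
  (a ++ [:: Open]) Close b isT.
rewrite -catA => loop.
rewrite /enc_seq bracket_cat.
apply: emits_seq (emits_fwd _ _ _) (loop _) => x.
by exists Open, (inner x ++ [:: Close]).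
Qed.

Definition nonblank (s : cell * cell) : bool := if s.1 is Some _ then true else false.

Definition rewind : prog :=
  Seq (While nonblank (Act (fun s => ((s.1, MoveLeft), (s.2, Stay))))) fwd.

(** The head has to start on a symbol: on the blank behind the input the loop would stop at once.
    Otherwise it stops on the blank in front of the input. *)
Lemma emits_rewind a z b : emits rewind a (z :: b) [::] [::] (a ++ z :: b).
Proof.
split=> // o; rewrite cats0.
apply: (runs_seq (t' := (Tape [::] None (map inS (a ++ z :: b)), output_at o))).
  apply: (runs_while (n := (size a).+1)).
    by rewrite size_cat /= addnS ltnS leq_addr.
  move: {1}(size _) => N; elim/last_ind: a z b => [|a x IHa] z b.
    apply: IteratesBody (runs_act _ _ _) _ => //.
    exact: IteratesDone.
  rewrite size_rcons; apply: IteratesBody (runs_act _ _ _) _ => //.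
  rewrite -cats1 -catA; have := IHa x (z :: b).
  by congr iterates; rewrite /act /tapes_at /input_at rev_cat.
have := runs_act (size (a ++ z :: b)) (fun s => ((s.1, MoveRight), (s.2, Stay)))
  (Tape [::] None (map inS (a ++ z :: b)), output_at o).
by congr runs.
Qed.

Lemma emits_cast p a b w a' b' w1 a1 :
  emits p a b w1 a1 b' -> w1 = w -> a1 = a' -> emits p a b w a' b'.
Proof. by move=> + <- <-. Qed.

(** * Writing the vertex names that belong to an item *)

Definition name_copy (tag : name) : prog :=
  Seq (emit (Open :: map bit tag)) (Seq (scan copy) (put Close)).

Definition code_copy : prog := Seq (scan (Seq (put One) copy)) (put Zero).

(** Such a program stops on the closing bracket of the item, whereas one satisfying [peeks] returns
    to its start. Both ends of an edge are written from the same item, the first by a [peeks]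
    program so that the second can read the item again. *)
Definition names (A : Type) (p : prog) (inner : A -> word) (nm : A -> name) : Prop :=
  forall x a b, emits p a (bracket (inner x) ++ b) (enc_name (nm x))
    (a ++ Open :: inner x) (Close :: b).

Definition peeks (A : Type) (p : prog) (inner : A -> word) (nm : A -> name) : Prop :=
  forall x a b, emits p a (bracket (inner x) ++ b) (enc_name (nm x))
    a (bracket (inner x) ++ b).

Lemma names_copy tag : names (name_copy tag) (map bit) (cat tag).
Proof.
move=> y a b; apply: emits_cast.
  apply: emits_seq (emits_emit _ _ _) _.
  apply: emits_seq (emits_scan (h := fun c => [:: bit c]) _ _ _ _) (emits_put _ _ _).
  by move=> c a' b'; apply: emits_copy.
  by rewrite flatten_bits /enc_name /bracket map_cat catA.
by [].
Qed.

Lemma emits_code_copy y a b : emits code_copy a (enc_name y ++ b) (map bit (code y))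
  (a ++ Open :: map bit y) (Close :: b).
Proof.
apply: emits_cast.
  apply: emits_seq (emits_put _ _ _).
  apply: (emits_scan (h := fun c => [:: One; bit c])) => c a' b'.
  exact: emits_seq (emits_put _ _ _) (emits_copy _ _ _).
  rewrite /code map_cat /=; congr cat.
  by elim: y => //= c y ->.
by [].
Qed.

Lemma peeks_const (A : Type) (inner : A -> word) (c : name) :
  peeks (emit (enc_name c)) inner (fun=> c).
Proof. by move=> x a b; apply: emits_emit. Qed.

Lemma emits_back_name y a b :
  emits back (a ++ Open :: map bit y) (Close :: b) [::] a (enc_name y ++ b).
Proof.
rewrite enc_name_cat; apply: emits_back.
by rewrite all_rcons /= all_not_open.
Qed.

Lemma peeks_copy tag : peeks (Seq (name_copy tag) back) (map bit) (cat tag).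
Proof.
move=> y a b; rewrite -[enc_name (tag ++ y)]cats0.
exact: emits_seq (names_copy _ _ _ _) (emits_back_name _ _ _).
Qed.

Definition triple_inner (t : name * name * name) : word :=
  enc_name t.1.1 ++ enc_name t.1.2 ++ enc_name t.2.

Definition triple_copy (tag : name) : prog :=
  Seq (emit (Open :: map bit tag)) (Seq fwd
  (Seq code_copy (Seq fwd (Seq code_copy (Seq fwd
  (Seq code_copy (Seq fwd (put Close)))))))).

Lemma names_triple tag : names (triple_copy tag) triple_inner
  (fun t => tag ++ code t.1.1 ++ code t.1.2 ++ code t.2).
Proof.
move=> t a b; rewrite bracket_cat /triple_inner.
apply: emits_cast.
  apply: emits_seq (emits_emit _ _ _) _.
  apply: emits_seq (emits_fwd _ _ _) _; rewrite -!catA.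
  apply: emits_seq (emits_code_copy _ _ _) _.
  apply: emits_seq (emits_fwd _ _ _) _.
  apply: emits_seq (emits_code_copy _ _ _) _.
  apply: emits_seq (emits_fwd _ _ _) _.
  apply: emits_seq (emits_code_copy _ _ _) _.
  apply: emits_seq (emits_fwd _ _ _) _.
  exact: emits_put.
  by rewrite /= /enc_name /bracket !map_cat /= -!catA.
by rewrite /enc_name /bracket /= -?catA /= -?catA.
Qed.

Definition skip_name : prog := Seq (scan fwd) fwd.

Lemma emits_skip_name y a b :
  emits skip_name a (enc_name y ++ b) [::] (a ++ enc_name y) b.
Proof.
apply: emits_cast.
  apply: emits_seq (emits_scan (h := fun=> [::]) _ _ _ _) (emits_fwd _ _ _).
  by move=> c a' b'; apply: emits_fwd.
  by elim: y => //=.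
by rewrite /enc_name /bracket -catA.
Qed.

Lemma emits_unskip_name y a z b :
  emits (Seq bwd back) (a ++ enc_name y) (z :: b) [::] a (enc_name y ++ z :: b).
Proof.
apply: (emits_seq (w := [::])) (emits_back_name _ _ _).
by have := emits_bwd (a ++ Open :: map bit y) Close z b; rewrite -catA.
Qed.

(** Since [back] stops at the nearest [Open], the skipped names of a triple are undone one at a
    time. *)
Definition around (i : nat) (p : prog) : prog :=
  iter i (fun p => Seq skip_name (Seq p (Seq bwd back))) p.

Definition elt_pick (i : nat) : prog :=
  Seq fwd (Seq (around i (Seq (name_copy [:: true; true]) back)) bwd).

Lemma emits_around p y a z b w :
  (forall a, emits p a (z :: b) w a (z :: b)) ->
  emits (Seq skip_name (Seq p (Seq bwd back))) a (enc_name y ++ z :: b) w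
    a (enc_name y ++ z :: b).
Proof.
move=> p_emits; apply: (emits_seq (w := [::])) (emits_skip_name _ _ _) _.
rewrite -[w]cats0; apply: emits_seq (p_emits _) _.
exact: emits_unskip_name.
Qed.

Lemma peeks_elt_pick (i : 'I_3) :
  peeks (elt_pick i) triple_inner (fun t => elt (proj i t)).
Proof.
have peek y a b : emits (Seq (name_copy [:: true; true]) back) a (enc_name y ++ b)
    (enc_name (elt y)) a (enc_name y ++ b).
  exact: peeks_copy.
move=> t a b; rewrite bracket_cat /triple_inner -!catA.
apply: (emits_seq (w := [::])) (emits_fwd _ _ _) _.
rewrite -[X in emits _ _ _ X]cats0.
apply: (emits_seq (a' := a ++ [:: Open])
  (b' := enc_name t.1.1 ++ enc_name t.1.2 ++ enc_name t.2 ++ Close :: b)); last first.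
  rewrite [enc_name t.1.1 ++ _]enc_name_cat; exact: emits_bwd.
case: i => [[|[|[|//]]] lt_i].
- exact: peek.
- rewrite [enc_name t.1.2 ++ _]enc_name_cat; apply: emits_around => a'.
  by rewrite -enc_name_cat; apply: peek.
- rewrite [enc_name t.1.2 ++ _]enc_name_cat; apply: emits_around => a'.
  rewrite -enc_name_cat [enc_name t.2 ++ _]enc_name_cat; apply: emits_around => a''.
  by rewrite -enc_name_cat; apply: peek.
Qed.

Definition vertex (p : prog) : prog := Seq p fwd.

Lemma emits_vertex (A : Type) p (inner : A -> word) nm : names p inner nm ->
  forall x a b, emits (vertex p) a (bracket (inner x) ++ b) (enc_name (nm x))
    (a ++ bracket (inner x)) b.
Proof.
move=> p_nm x a b; apply: emits_cast.
  exact: emits_seq (p_nm _ _ _) (emits_fwd _ _ _).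
  by rewrite cats0.
by rewrite -catA.
Qed.

Definition wedge (q p : prog) (wt : bool) : prog :=
  Seq (put Open) (Seq q (Seq p (Seq (emit [:: bit wt; Close]) fwd))).

Lemma emits_wedge (A : Type) q p wt (inner : A -> word) nm nm' :
  peeks q inner nm -> names p inner nm' ->
  forall x a b, emits (wedge q p wt) a (bracket (inner x) ++ b)
    (enc_wedge (nm x, nm' x, wt)) (a ++ bracket (inner x)) b.
Proof.
move=> q_nm p_nm x a b; apply: emits_cast.
  apply: emits_seq (emits_put _ _ _) _.
  apply: emits_seq (q_nm _ _ _) _.
  apply: emits_seq (p_nm _ _ _) _.
  exact: emits_seq (emits_emit _ _ _) (emits_fwd _ _ _).
  by rewrite /enc_wedge [RHS]/bracket -!catA.
by rewrite -catA.
Qed.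

(** * Passes over the whole input *)

(** The head may start on any symbol and ends on some symbol, so outputs can be concatenated without
    tracking its position. *)
Definition sweeps (s : word) (p : prog) (w : word) : Prop :=
  forall a z b, a ++ z :: b = s ->
    exists a' z' b', emits p a (z :: b) w a' (z' :: b').

Lemma sweeps_seq s p q w w' :
  sweeps s p w -> sweeps s q w' -> sweeps s (Seq p q) (w ++ w').
Proof.
move=> p_w q_w a z b ab; have [a' [z' [b' p_emits]]] := p_w a z b ab.
have [a'' [z'' [b'' q_emits]]] := q_w a' z' b' (etrans p_emits.1 ab).
by exists a'', z'', b''; apply: emits_seq p_emits q_emits.
Qed.

Lemma sweeps_emit s w : sweeps s (emit w) w.
Proof. by move=> a z b _; exists a, z, b; apply: emits_emit. Qed.

Definition section_body (j : nat) (body : prog) : prog :=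
  iter j (Seq (Seq (each skip_name) fwd)) (each body).

Definition pass (j : nat) (body : prog) : prog := Seq rewind (section_body j body).

(** Rewinding makes the starting position irrelevant, and the pass ends on the closing bracket of
    the list just read, from which a further pass can rewind. *)
Lemma sweeps_pass (A : Type) body (inner h : A -> word) :
  (forall x a b, emits body a (bracket (inner x) ++ b) (h x) (a ++ bracket (inner x)) b) ->
  forall xs (ls : seq (seq name)) rest,
  sweeps (flatten (map (enc_seq enc_name) ls) ++ enc_seq (bracket \o inner) xs ++ rest)
    (pass (size ls) body) (flatten (map h xs)).
Proof.
move=> body_emits xs ls rest a z b ab.
suff [a' section_emits] : exists a', emits (section_body (size ls) body) [::] (a ++ z :: b)
    (flatten (map h xs)) a' (Close :: rest).
  exists a', Close, rest.
  exact: (emits_seq (w := [::])) (emits_rewind _ _ _) section_emits.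
rewrite {}ab; move: [::]; elim: ls => [|l ls IHls] c /=.
  by eexists; apply: emits_each.
have [a' ls_emits] := IHls (c ++ enc_seq enc_name l).
exists a'; apply: (emits_seq (w := [::])) ls_emits.
rewrite -catA; apply: emits_cast.
  apply: emits_seq (emits_fwd _ _ _).
  apply: (emits_each (inner := map bit) (h := fun=> [::])) => y a'' b''.
  exact: emits_skip_name.
  by elim: (l).
by rewrite -catA.
Qed.

(** * The machine for the reduction *)

Definition tdm_word (us vs ws : seq name) (ts : seq (name * name * name)) : word :=
  enc_seq enc_name us ++ enc_seq enc_name vs ++ enc_seq enc_name ws ++
  enc_seq enc_triple ts.

Definition smst_graphs (us vs ws : seq name) (ts : seq (name * name * name)) (i : 'I_3) :
    seq name * seq (name * name * bool) :=
  (vert_list us (proj i (us, vs, ws)) ts i, edge_list us ts i).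

Definition smst_word (us vs ws : seq name) (ts : seq (name * name * name)) : word :=
  enc_seq enc_wgraph [seq smst_graphs us vs ws ts i | i <- enum 'I_3].

Lemma sweeps_names us vs ws ts (j : 'I_3) body (h : name -> word) :
  (forall y a b, emits body a (enc_name y ++ b) (h y) (a ++ enc_name y) b) ->
  sweeps (tdm_word us vs ws ts) (pass j body) (flatten (map h (proj j (us, vs, ws)))).
Proof.
move=> body_emits.
have pass_names := sweeps_pass (inner := map bit) body_emits.
case: j => [[|[|[|//]]] lt_j].
- exact: (pass_names us [::]
    (enc_seq enc_name vs ++ enc_seq enc_name ws ++ enc_seq enc_triple ts)).
- have := pass_names vs [:: us] (enc_seq enc_name ws ++ enc_seq enc_triple ts).
  by rewrite /= cats0.
- have := pass_names ws [:: us; vs] (enc_seq enc_triple ts).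
  by rewrite /= cats0 -catA.
Qed.

Lemma sweeps_triples us vs ws ts body (h : name * name * name -> word) :
  (forall t a b, emits body a (enc_triple t ++ b) (h t) (a ++ enc_triple t) b) ->
  sweeps (tdm_word us vs ws ts) (pass 3 body) (flatten (map h ts)).
Proof.
move=> body_emits.
have pass_triples := sweeps_pass (inner := triple_inner) body_emits.
have := pass_triples ts [:: us; vs; ws] [::].
congr sweeps; rewrite /tdm_word cats0 -[flatten _]/(_ ++ _ ++ _ ++ [::]).
by rewrite cats0 -!catA.
Qed.

Definition graph_prog (i : 'I_3) : prog :=
  let elt_copy := name_copy [:: true; true] in
  let inl_copy := name_copy [:: true; false] in
  let inr_copy := triple_copy [:: false; true] in
  let owner_inl := if i == 0 :> nat then Seq elt_copy back else emit (enc_name (cap i)) in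
  foldr Seq (emit [:: Close; Close])
    [:: emit (Open :: Open :: enc_name hub ++ enc_name (cap i));
        pass i (vertex elt_copy); pass 0 (vertex inl_copy); pass 3 (vertex inr_copy);
        emit (Close :: Open :: enc_wedge (cap i, hub, false));
        pass 0 (wedge (emit (enc_name hub)) inl_copy true);
        pass 3 (wedge (emit (enc_name hub)) inr_copy true);
        pass 0 (wedge owner_inl inl_copy false);
        pass 3 (wedge (elt_pick i) inr_copy false)].

Lemma sweeps_cast s p w w' : sweeps s p w -> w = w' -> sweeps s p w'.
Proof. by move=> + <-. Qed.

Lemma sweeps_graph us vs ws ts i :
  sweeps (tdm_word us vs ws ts) (graph_prog i) (enc_wgraph (smst_graphs us vs ws ts i)).
Proof.
rewrite /graph_prog; set owner_inl := (if _ then _ else _).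
have peeks_owner : peeks owner_inl (map bit) (fun u => owner i (inl u)).
  rewrite /owner_inl /=.
  by case: ifP => _; [apply: peeks_copy | exact: (@peeks_const _ _ (cap i))].
have pass0 := @sweeps_names us vs ws ts ord0.
apply: sweeps_cast.
  apply: sweeps_seq (@sweeps_emit _ _) _.
  apply: sweeps_seq (sweeps_names _ (emits_vertex (@names_copy _))) _.
  apply: sweeps_seq (pass0 _ _ (emits_vertex (@names_copy _))) _.
  apply: sweeps_seq (sweeps_triples (emits_vertex (@names_triple _))) _.
  apply: sweeps_seq (@sweeps_emit _ _) _.
  apply: sweeps_seq (pass0 _ _ (emits_wedge _ (@peeks_const _ _ _) (@names_copy _))) _.
  apply: sweeps_seq (sweeps_triples (emits_wedge _ (@peeks_const _ _ _) (@names_triple _))) _.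
  apply: sweeps_seq (pass0 _ _ (emits_wedge _ peeks_owner (@names_copy _))) _.
  apply: sweeps_seq (sweeps_triples (emits_wedge _ (@peeks_elt_pick _) (@names_triple _))) _.
  exact: sweeps_emit.
rewrite /enc_wgraph /smst_graphs /vert_list /edge_list /enc_seq /items.
rewrite [bracket]lock !map_cons !map_cat -!map_comp -lock.
rewrite -[flatten [:: enc_name hub, _ & _]]/(_ ++ _ ++ flatten _).
rewrite -[flatten (enc_wedge _ :: _)]/(_ ++ flatten _).
by rewrite !flatten_cat /bracket !(cat_cons, =^~ catA).
Qed.
Definition run_left : prog := Act (fun s => ((s.1, Stay), (s.2, MoveLeft))).

(** [output] reads rightwards from the head, which appending has left on the blank behind the last
    symbol. The first move leaves that blank, so that the loop can start. *)
Definition output_rewind : prog :=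
  Seq run_left (Seq (While (fun s => if s.2 is Some _ then true else false) run_left)
    (Act (fun s => ((s.1, Stay), (s.2, MoveRight))))).

Lemma runs_output_rewind N t o : size o <= N ->
  runs N output_rewind (t, output_at o)
    (t, Tape [:: None] (head None (map inS o ++ [:: None]))
             (behead (map inS o ++ [:: None]))).
Proof.
move=> le_oN.
apply: runs_seq (runs_act _ _ _) _.
apply: (runs_seq (t' := (t, Tape [::] None (map inS o ++ [:: None])))); last first.
  have := runs_act N (fun s => ((s.1, Stay), (s.2, MoveRight)))
    (t, Tape [::] None (map inS o ++ [:: None])).
  by case: t.
apply: (runs_while le_oN); rewrite /act /=.
have -> : write (cur t) t = t by case: t.
elim/last_ind: o {le_oN} [:: None] => [|o x IHo] r /=.
  exact: IteratesDone.
rewrite size_rcons rev_rcons; apply: IteratesBody (runs_act _ _ _) _ => //.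
rewrite map_rcons cat_rcons.
have := IHo (inS x :: r).
by congr iterates; rewrite /act; case: (t).
Qed.

Definition writer : prog :=
  Seq (emit [:: Open])
    (foldr (fun i => Seq (graph_prog i)) (emit [:: Close]) (enum 'I_3)).

Lemma sweeps_writer us vs ws ts :
  sweeps (tdm_word us vs ws ts) writer (smst_word us vs ws ts).
Proof.
rewrite /smst_word /enc_seq -[bracket _]/([:: Open] ++ _).
apply: sweeps_seq (@sweeps_emit _ _) _.
elim: (enum 'I_3) => [|i s IHs]; first exact: sweeps_emit.
rewrite -[flatten _]/(enc_wgraph (smst_graphs us vs ws ts i) ++ flatten _) -catA.
exact: sweeps_seq (@sweeps_graph us vs ws ts i) IHs.
Qed.

Definition copier : prog := Seq bwd (Seq fwd writer).
Definition transducer : prog := Seq copier output_rewind.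

(* The output may be longer than the input, so the loop of [output_rewind] is
   bounded by the running time of [copier] instead of the input length. *)
Definition transducer_time : {poly nat} :=
  (bound copier + (bound output_rewind \Po bound copier))%R.

Lemma read_cells o : read (map inS o ++ [:: None]) = o.
Proof. by elim: o => //= x o ->. Qed.

Lemma transducer_computes us vs ws ts :
  computes_within (machine transducer) (transducer_time.[size (tdm_word us vs ws ts)])%R
    (tdm_word us vs ws ts) (smst_word us vs ws ts).
Proof.
set s := tdm_word us vs ws ts.
have [z [b def_s]] : exists z b, s = z :: b by eexists; eexists.
have [|a' [z' [b' [_ /(_ [::])]]]] := @sweeps_writer us vs ws ts [::] z b.
  by rewrite cat0s -def_s.
rewrite !cat0s -def_s => run_writer.
have run_copier : runs (size s) copier (input_tape void s, input_tape void [::])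
    (tapes_at a' (z' :: b') (smst_word us vs ws ts)).
  apply: runs_seq (runs_act _ _ _) _; apply: runs_seq (runs_act _ _ _) _.
  by move: run_writer; rewrite def_s.
set o := smst_word us vs ws ts in run_copier *.
have le_o : size o <= (bound copier).[size s]%R.
  by have := reaches_left_size run_copier; rewrite /= size_map size_rev.
have run_all := reaches_seq run_copier (runs_output_rewind _ le_o).
have -> : o = read (head None (map inS o ++ [:: None]) :: behead (map inS o ++ [:: None])).
  by rewrite -[RHS]/(read _) -[LHS]read_cells; case: (map inS o).
rewrite /transducer_time hornerD horner_comp.
exact: (machine_computes run_all).
Qed.

(** * Unique parsing and correctness *)

(** Unique parsing in front of an arbitrary continuation, a property inherited by concatenations of
    codes. *)
Definition prefix_code (A : Type) (enc : A -> word) : Prop :=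
  forall x y s s', enc x ++ s = enc y ++ s' -> x = y /\ s = s'.

Lemma bracket_cat_inj w w' s s' :
  bracket w ++ s = bracket w' ++ s' -> w ++ Close :: s = w' ++ Close :: s'.
Proof. by rewrite !bracket_cat => -[]. Qed.

Lemma enc_name_prefix : prefix_code enc_name.
Proof.
move=> x y s s' /bracket_cat_inj.
elim: x y => [|b x IHx] [|c y] /=; first by case.
- by case: c.
- by case: b.
- by case=> bc /IHx[-> ->]; move: bc; case: b; case: c.
Qed.

(** The initial [Open] of an entry distinguishes it from the [Close] that ends the list. *)
Lemma enc_seq_prefix (A : Type) (enc : A -> word) :
  prefix_code enc -> (forall x, exists w, enc x = Open :: w) ->
  prefix_code (enc_seq enc).
Proof.
move=> enc_prefix enc_open l l' s s' /bracket_cat_inj.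
elim: l l' => [|x l IHl] [|y l'] /=; first by case.
- by have [w ->] := enc_open y.
- by have [w ->] := enc_open x.
by rewrite -!catA => /enc_prefix[-> /IHl[-> ->]].
Qed.

Lemma enc_wedge_prefix : prefix_code enc_wedge.
Proof.
move=> [[x y] b] [[x' y'] b'] s s' /bracket_cat_inj; rewrite -!catA.
move=> /enc_name_prefix[/= -> /enc_name_prefix[-> []]].
by case: b; case: b' => // ->.
Qed.

Lemma enc_wgraph_prefix : prefix_code enc_wgraph.
Proof.
move=> [vs es] [vs' es'] s s' /bracket_cat_inj; rewrite -!catA.
have names_prefix : prefix_code (enc_seq enc_name).
  by apply: enc_seq_prefix => [|x]; [apply: enc_name_prefix | eexists].
have wedges_prefix : prefix_code (enc_seq enc_wedge).
  by apply: enc_seq_prefix => [|x]; [apply: enc_wedge_prefix | eexists].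
by move=> /names_prefix[/= -> /wedges_prefix[-> []]].
Qed.

(** Hence every instance encoded by the output word has exactly the constructed edges and weights,
    and [solution_matching] applies to it. *)
Lemma smst_word_inj us vs ws ts (G : 'I_3 -> seq name * seq (name * name * bool)) :
  smst_word us vs ws ts = enc_seq enc_wgraph [seq G i | i <- enum 'I_3] ->
  forall i, G i = smst_graphs us vs ws ts i.
Proof.
have graphs_prefix : prefix_code (enc_seq enc_wgraph).
  by apply: enc_seq_prefix => [|x]; [apply: enc_wgraph_prefix | eexists].
rewrite -[LHS]cats0 -[RHS]cats0 => /graphs_prefix[/eq_in_map eqG _] i.
by rewrite eqG ?mem_enum.
Qed.

(** Taking the output of the machine as the reduction makes it a total function of the word,
    independent of any choice of decoding. *)
Definition transduce (s : word) : word :=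
  output (iter (transducer_time.[size s])%R (@step (machine transducer))
    (init (machine transducer) s)).

Lemma transduce_tdm_word us vs ws ts :
  transduce (tdm_word us vs ws ts) = smst_word us vs ws ts.
Proof. by have [] := transducer_computes us vs ws ts. Qed.

Section Correctness.

Variables (R : realType) (I : tdm) (us vs ws : seq name) (ts : seq (name * name * name)).
Hypotheses (usE : perm_eq us (tdmU I)) (vsE : perm_eq vs (tdmV I)).
Hypotheses (wsE : perm_eq ws (tdmW I)) (tsE : perm_eq ts (tdmT I)).
Hypothesis I_valid : tdm_valid I.

Lemma encodes_matching (J : smst R 3) : encodes_smst01 (smst_word us vs ws ts) J ->
  (exists T, smst_solution J T) <-> has_3d_matching I.
Proof.
case=> vl [el [_ el_edges el_weight /smst_word_inj eqG]].
apply: (solution_matching usE vsE wsE tsE I_valid) => [i e|i e].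
  by have [_ <-] := eqG i; rewrite (perm_mem (el_edges i)).
by have [_ <-] := eqG i; apply: el_weight.
Qed.

Lemma encodes_exists : exists J : smst R 3,
  encodes_smst01 (smst_word us vs ws ts) J /\ cap01 J.
Proof.
have [J [J_verts J_edges J_weight]] := encoded_instance usE vsE wsE tsE R.
exists J; split.
  by exists (fun i => (smst_graphs us vs ws ts i).1), (fun i => (smst_graphs us vs ws ts i).2).
by apply: (encoded_cap01 usE vsE wsE tsE I_valid) => // i e; apply: esym; apply: perm_mem.
Qed.

End Correctness.

Theorem theorem1 (R : realType) :
  poly_reduces three_dim_matching (cap01_smst R 3).
Proof.
exists transduce; split.
  exists (machine transducer), transducer_time.
  move=> _ [I [[us [vs [ws [ts [_ _ _ _ ->]]]]] _]].
  by rewrite -/(tdm_word us vs ws ts) transduce_tdm_word; apply: transducer_computes.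
move=> s [I [[us [vs [ws [ts [usE vsE wsE tsE def_s]]]]] I_valid]].
have -> : transduce s = smst_word us vs ws ts by rewrite def_s transduce_tdm_word.
split; first exact: (encodes_exists R usE vsE wsE tsE I_valid).
split=> [[I' [[us' [vs' [ws' [ts' [usE' vsE' wsE' tsE' def_s']]]]] I'_valid I'_match]]|].
  (* The witness of the yes-instance comes with its own lists; both output words are the value of
     [transduce] at the same [s]. *)
  have -> : smst_word us vs ws ts = smst_word us' vs' ws' ts'.
    by rewrite -!transduce_tdm_word -[tdm_word us vs ws ts]def_s -[tdm_word us' _ _ _]def_s'.
  have [J [J_enc J_cap]] := encodes_exists R usE' vsE' wsE' tsE' I'_valid.
  exists J; split=> //.
  by apply/(encodes_matching usE' vsE' wsE' tsE' I'_valid J_enc).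
case=> J [J_enc _ J_sol]; exists I; split=> //.
  by exists us, vs, ws, ts.
by apply/(encodes_matching usE vsE wsE tsE I_valid J_enc).
Qed.
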